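(* Let $N$ be a nonempty finite set of nonnegative integers and let $B^{(N)}$ be the disjoint union of the Bellaterra type automata $B^{(n)}$, $n\in N$. Then the group $G(B^{(N)})$ is the free product of $\sum_{n\in N}(2n+1)$ groups of order $2$.
   Context: An automaton is a quadruple $(Q,X,\phi,\psi)$ with nonempty sets $Q$ (internal states) and $X$ (finite alphabet), a state transition function $\phi:Q\times X\to Q$ and an output function $\psi:Q\times X\to X$. Let $X^*$ be the set of finite words over $X$ (including the empty word). For an automaton $Y=(Q,X,\phi,\psi)$ and $q\in Q$, the transformation $Y_q:X^*\to X^*$ is defined recursively by $Y_q(\varnothing)=\varnothing$ and $Y_q(xw)=\psi(q,x)\,Y_{\phi(q,x)}(w)$ for $x\in X$, $w\in X^*$. $Y$ is invertible if all $Y_q$, $q\in Q$, are bijective; then $G(Y)$ is the group of transformations of $X^*$ generated (under composition) by $Y_q$, $q\in Q$. Bellaterra type automata: for $n\ge1$, $B^{(n)}=(Q_n,\{0,1\},\phi_n,\widehat\psi_n)$, where $Q_1=\{a_1,b_1,c_1\}$ and $Q_n=\{a_n,b_n,c_n,q_{n1},\dots,q_{n,2n-2}\}$ for $n\ge2$ (a set of $2n+1$ elements). With $q_{n0}:=c_n$ and $q_{n,2n-1}:=a_n$: $\phi_n(a_n,0)=\phi_n(b_n,1)=c_n$, $\phi_n(a_n,1)=\phi_n(b_n,0)=b_n$, and $\phi_n(q_{ni},0)=\phi_n(q_{ni},1)=q_{n,i+1}$ for $0\le i\le 2n-2$. For $x\in\{0,1\}$: $\widehat\psi_n(q,x)=x$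 if $q\in\{a_n,b_n\}$, and $\widehat\psi_n(q,x)=1-x$ if $q\in Q_n\setminus\{a_n,b_n\}$. Further, $B^{(0)}$ is the one-state automaton over $\{0,1\}$ with state set $Q_0=\{c_0\}$, transitions $c_0\mapsto c_0$ for both letters, and output function interchanging $0$ and $1$. The sets $Q_n$, $n\ge0$, are pairwise disjoint, and these automata are invertible. The disjoint union of finitely many automata over the same alphabet $X$ with pairwise disjoint state sets is the automaton over $X$ whose state set is the union of the state sets and whose transition and output functions restrict to those of each component. *)

(* Defs.v *)
From HB Require Import structures.
From mathcomp Require Import all_boot all_fingroup.
From mathcomp Require Import finmap boolp.

Set Implicit Arguments.
Unset Strict Implicit.
Unset Printing Implicit Defensive.

Record sym (T : Type) := Sym { sym_fun :> T -> T; sym_bij : bijective sym_fun }.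

HB.instance Definition _ (T : Type) := gen_eqMixin (sym T).
HB.instance Definition _ (T : Type) := gen_choiceMixin (sym T).

Section SymGroup.
Variable T : Type.
Implicit Types s t u : sym T.

Lemma sym_ext s t : s =1 t -> s = t.
Proof.
by case: s t => [f bf] [g bg] /= /funext fg; subst g; congr Sym; exact: Prop_irrelevance.
Qed.

Definition sym_one : sym T := @Sym T id (Bijective (frefl id) (frefl id)).

Definition sym_mul s t : sym T := Sym (bij_comp (sym_bij s) (sym_bij t)).

Lemma sym_inv_ex s : exists g, cancel s g /\ cancel g s.
Proof. by case: (sym_bij s) => g; exists g. Qed.

Definition sym_inv_fun s : T -> T := projT1 (cid (sym_inv_ex s)).

Lemma sym_funK s : cancel s (sym_inv_fun s).
Proof. by rewrite /sym_inv_fun; case: cid => g []. Qed.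

Lemma sym_inv_funK s : cancel (sym_inv_fun s) s.
Proof. by rewrite /sym_inv_fun; case: cid => g []. Qed.

Definition sym_inv s : sym T := Sym (Bijective (sym_inv_funK s) (@sym_funK s)).

Lemma sym_mulA : associative sym_mul.
Proof. by move=> s t u; exact: sym_ext. Qed.

Lemma sym_mul1s : left_id sym_one sym_mul.
Proof. by move=> s; exact: sym_ext. Qed.

Lemma sym_muls1 : right_id sym_one sym_mul.
Proof. by move=> s; exact: sym_ext. Qed.

Lemma sym_mulVs : left_inverse sym_one sym_inv sym_mul.
Proof. by move=> s; apply: sym_ext => x /=; exact: sym_funK. Qed.

Lemma sym_mulsV : right_inverse sym_one sym_inv sym_mul.
Proof. by move=> s; apply: sym_ext => x /=; exact: sym_inv_funK. Qed.

HB.instance Definition _ := isGroup.Build (sym T)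
  sym_mulA sym_mul1s sym_muls1 sym_mulVs sym_mulsV.

End SymGroup.

Section Generated.
Variables (G : groupType) (A : G -> Prop).

Definition gen_by : {pred G} := fun g =>
  `[< forall S : {pred G}, group_closed S -> (forall a, A a -> a \in S) -> g \in S >].

Lemma gen_by_closed : group_closed gen_by.
Proof.
split=> [|g h /asboolP gP /asboolP hP]; apply/asboolP => S clS AS.
  by case: clS.
by case: (clS) => _; apply; [exact: gP | exact: hP].
Qed.

Definition gen_by_group := {g : G | g \in gen_by}.

HB.instance Definition _ := Choice.on gen_by_group.
HB.instance Definition _ := SubType.on gen_by_group.
HB.instance Definition _ :=
  SubChoice_isSubGroup.Build G gen_by gen_by_group gen_by_closed.

End Generated.

(* [G], with the maps [iota i : H i -> G], is the free product (coproduct in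
   the category of groups) of the family [H]. *)
Definition is_free_product (I : Type) (H : I -> groupType) (G : groupType)
    (iota : forall i, {multiplicative H i -> G}) : Prop :=
  forall (K : groupType) (f : forall i, {multiplicative H i -> K}),
  exists g : {multiplicative G -> K},
    (forall i, g \o iota i =1 f i) /\
    (forall g' : {multiplicative G -> K},
       (forall i, g' \o iota i =1 f i) -> g' =1 g).

Record automaton (X : finType) := Automaton {
  state : Type;
  trans : state -> X -> state;
  output : state -> X -> X;
  state_inhabited : inhabited state;
  alphabet_inhabited : inhabited X
}.

Section Automata.
Variable X : finType.
Implicit Type Y : automaton X.

Fixpoint act Y (q : state Y) (w : seq X) : seq X :=
  if w is x :: w' then output q x :: act (trans q x) w' else [::].

Definition invertible Y : Prop := forall q : state Y, bijective (act q).

Definition automaton_group Y (invY : invertible Y) : groupType :=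
  gen_by_group (fun s : sym (seq X) => exists q : state Y, s = Sym (invY q)).

Lemma invertible_output Y :
  (forall q : state Y, bijective (output q)) -> invertible Y.
Proof.
move=> bY.
have /choice[r rP] (q : state Y) :
    exists r, cancel (output q) r /\ cancel r (output q).
  by case: (bY q) => r; exists r.
pose back := fix back (w : seq X) (q : state Y) : seq X :=
  if w is x :: w' then r q x :: back w' (trans q (r q x)) else [::].
move=> q; exists (back^~ q) => w; elim: w q => //= x w IHw q.
  by rewrite (rP q).1 IHw.
by rewrite (rP q).2 IHw.
Qed.

Definition disjoint_union (I : finType) (I_inh : inhabited I)
    (Y : I -> automaton X) : automaton X :=
  @Automaton X {i : I & state (Y i)}
    (fun q x => Tagged (fun i => state (Y i)) (trans (tagged q) x))
    (fun q x => output (tagged q) x)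
    (let: inhabits i := I_inh in
     let: inhabits q := state_inhabited (Y i) in
     inhabits (Tagged (fun i => state (Y i)) q))
    (let: inhabits i := I_inh in alphabet_inhabited (Y i)).

End Automata.

(* The letters 0 and 1 are [false] and [true]. *)

Definition bell0 : automaton bool :=
  @Automaton bool unit (fun q _ => q) (fun _ x => ~~ x) (inhabits tt) (inhabits true).

(* For n >= 1, [Sq i] is q_{ni} for 0 <= i <= 2n-2; in particular
   [Sq 0] is c_n = q_{n0}. *)
Inductive bell_state (n : nat) := Sa | Sb | Sq of 'I_(2 * n - 1).
Arguments Sa {n}.
Arguments Sb {n}.

(* q_{ni} for 0 <= i <= 2n-1, where q_{n,2n-1} = a_n *)
Definition bell_q (n i : nat) : bell_state n :=
  if insub i is Some j then Sq j else Sa.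

Definition bell_trans n (q : bell_state n) (x : bool) : bell_state n :=
  match q with
  | Sa => if x then Sb else bell_q n 0
  | Sb => if x then bell_q n 0 else Sb
  | Sq i => bell_q n i.+1
  end.

Definition bell_output n (q : bell_state n) (x : bool) : bool :=
  match q with
  | Sa | Sb => x
  | Sq _ => ~~ x
  end.

Definition bellaterra (n : nat) : automaton bool :=
  if n is 0 then bell0
  else @Automaton bool (bell_state n) (@bell_trans n) (@bell_output n)
         (inhabits Sa) (inhabits true).

Lemma bellaterra_output_bij n (q : state (bellaterra n)) : bijective (output q).
Proof.
case: n q => [|n] q /=; first exact: (Bijective negbK negbK).
by case: q => [||i]; [exists id | exists id | exact: (Bijective negbK negbK)].
Qed.

Lemma fset_neq0_inhabited (N : {fset nat}) : N != fset0 -> inhabited N.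
Proof. by move/fset0Pn/cid => [n nN]; exact: (inhabits [` nN]%fset). Qed.

Definition bellaterra_union (N : {fset nat}) (N_neq0 : N != fset0) : automaton bool :=
  disjoint_union (fset_neq0_inhabited N_neq0) (fun n : N => bellaterra (val n)).

Lemma bellaterra_union_invertible (N : {fset nat}) (N_neq0 : N != fset0) :
  invertible (bellaterra_union N_neq0).
Proof. by apply: invertible_output => q; exact: bellaterra_output_bij. Qed.

(* Main.v *)
(* A word q_1 ... q_k of states acts on binary words; dually, each letter read
   moves the word of states, and the composition is trivial only if every word
   reachable from q_1 ... q_k contains an even number of flipping states (states
   other than a_n, b_n).  It suffices to show that the dual action is transitive
   on the non-repeating words with a given pattern of component indices, and
   that the parity of flipping states is not a coboundary on such an orbit.

   Transitivity comes from a stronger statement, proved by induction on the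
   length: the loops at a non-repeating word w induce, on the letters of any
   component put next to w, every permutation fixing the adjacent letter of w.
   A loop at w acts simultaneously on letters put at both ends of w; the pairs
   of permutations so obtained form a subdirect product of two symmetric groups,
   which by Goursat's argument is the whole product as soon as the two signs are
   independent.  The two signs differ by the number of steps of the loop at which
   the current word has odd parity, so their independence is again the fact that
   the parity is not a coboundary.  That fact is reduced, by summing over the
   first letter and peeling letters off the other end (where two-fold
   transitivity on the end letter is used), to a word of length one, where the
   fixed point b_n of the letter 0 gives a contradiction. *)

From HB Require Import structures.
Require Import Defs.
From mathcomp Require Import all_boot all_fingroup all_algebra.
From mathcomp Require Import finmap boolp.

Set Implicit Arguments.
Unset Strict Implicit.
Unset Printing Implicit Defensive.
Import GroupScope.

(** * Symmetric groups of a subset: transitivity and normal subgroups *)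

Section SymmetricGroup.
Variables (T : finType) (S : {set T}).
Implicit Types (s g : {perm T}) (N : {group {perm T}}).

Lemma perm_on_tperm x y : x \in S -> y \in S -> perm_on S (tperm x y).
Proof.
move=> xS yS; apply: subset_trans (tperm_on x y) _.
by apply/subsetP => z /set2P[] ->.
Qed.

(** Induction on the number of moved points: if [s] moves [x], then [tperm x (s x) * s] fixes [s x]
    in addition to the fixed points of [s]. *)
Lemma perm_on_ind (P : {perm T} -> Prop) :
    P 1 ->
    (forall x y s, x \in S -> y \in S -> perm_on S s -> P s ->
       P (tperm x y * s)) ->
  forall s, perm_on S s -> P s.
Proof.
move=> P1 PM s; have [m] := ubnP #|[set x | s x != x]|.
elim: m s => // m IHm s lt_m Ss.
have [x sx|fix_s] := pickP (fun x => s x != x); last first.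
  by suff ->: s = 1 by []; apply/permP => x; rewrite perm1; apply/eqP/negbFE/fix_s.
have xS : x \in S by apply: contraNT sx => /(out_perm Ss) ->.
have sxS : s x \in S by rewrite (perm_closed _ Ss).
have ssx : s (s x) != s x by rewrite (inj_eq perm_inj).
rewrite -[s](mulKg (tperm x (s x))) tpermV.
have St : perm_on S (tperm x (s x) * s) by apply: perm_onM Ss; apply: perm_on_tperm.
apply: PM => //; apply: IHm => //; rewrite -ltnS; apply: leq_trans lt_m.
apply/proper_card/properP; split.
  apply/subsetP => z; rewrite !inE permM; case: tpermP => [-> //|->|//].
  by rewrite eqxx.
by exists (s x); rewrite !inE ?permM ?tpermR ?eqxx.
Qed.

Lemma perm_on_3transitive x y z a b c :
    x \in S -> y \in S -> z \in S -> a \in S -> b \in S -> c \in S ->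
    uniq [:: x; y; z] -> uniq [:: a; b; c] ->
  exists g, [/\ perm_on S g, g x = a, g y = b & g z = c].
Proof.
move=> xS yS zS aS bS cS /=; rewrite !inE !negb_or !andbT.
move=> /andP[/andP[xy xz] yz] /andP[/andP[ab ac] bc].
pose g1 := tperm x a; pose g2 := g1 * tperm (g1 y) b.
have g1x : g1 x = a by rewrite tpermL.
have Sg1 : perm_on S g1 by apply: perm_on_tperm.
have Sg2 : perm_on S g2.
  by apply: perm_onM => //; apply: perm_on_tperm => //; rewrite (perm_closed _ Sg1).
have g2x : g2 x = a.
  by rewrite permM g1x tpermD // 1?eq_sym // -g1x (inj_eq perm_inj).
have g2y : g2 y = b by rewrite permM tpermL.
exists (g2 * tperm (g2 z) c); split.
- by apply: perm_onM => //; apply: perm_on_tperm => //; rewrite (perm_closed _ Sg2).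
- by rewrite permM g2x tpermD // 1?eq_sym // -g2x (inj_eq perm_inj).
- by rewrite permM g2y tpermD // 1?eq_sym // -g2y (inj_eq perm_inj).
by rewrite permM tpermL.
Qed.

Lemma perm_on_2transitive x y a b :
    x \in S -> y \in S -> a \in S -> b \in S -> x != y -> a != b ->
  exists g, [/\ perm_on S g, g x = a & g y = b].
Proof.
move=> xS yS aS bS xy ab; pose g1 := tperm x a.
have g1x : g1 x = a by rewrite tpermL.
have Sg1 : perm_on S g1 by apply: perm_on_tperm.
exists (g1 * tperm (g1 y) b); split; last by rewrite permM tpermL.
  by apply: perm_onM => //; apply: perm_on_tperm => //; rewrite (perm_closed _ Sg1).
by rewrite permM g1x tpermD // 1?eq_sym // -g1x (inj_eq perm_inj).
Qed.

(** Conjugation spreads the given 3-cycle to all 3-cycles on [S]; these give all products of two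
    transpositions, which build up every even permutation. *)
Lemma even_perm_normal N x y z :
    (forall g s, perm_on S g -> s \in N -> s ^ g \in N) ->
    x \in S -> y \in S -> z \in S -> uniq [:: x; y; z] ->
    tperm x y * tperm y z \in N ->
  forall s, perm_on S s -> ~~ odd_perm s -> s \in N.
Proof.
move=> nN xS yS zS xyz N3.
have N3all a b c : a \in S -> b \in S -> c \in S ->
    a != b -> b != c -> tperm a b * tperm b c \in N.
  move=> aS bS cS ab bc; have [<-|ac] := eqVneq a c.
    by rewrite (tpermC b) tperm2.
  have [|g [Sg <- <- <-]] := perm_on_3transitive xS yS zS aS bS cS xyz.
    by rewrite /= !inE negb_or ab ac bc.
  by rewrite -!tpermJ -conjMg nN.
have N2 a b c d : a \in S -> b \in S -> c \in S -> d \in S ->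
    a != b -> c != d -> tperm a b * tperm c d \in N.
  move=> aS bS cS dS ab cd; have [bc|bc] := eqVneq b c.
    by rewrite -bc in cd *; apply: N3all.
  rewrite -[tperm a b](mulgK (tperm b c)) tpermV -mulgA.
  by rewrite groupM ?N3all.
have xy : x != y by move: xyz; rewrite /= !inE !negb_or -andbA => /andP[].
(* The factor [tperm x y] makes odd permutations even, so that the induction can add one
   transposition at a time. *)
suff H s : perm_on S s -> (if odd_perm s then tperm x y * s else s) \in N.
  by move=> s Ss /negbTE odds; have := H s Ss; rewrite odds.
move: s; apply: perm_on_ind => [|a b s aS bS Ss]; first by rewrite odd_perm1.
have [->|ab] := eqVneq a b; first by rewrite tperm1 mul1g.
rewrite odd_permM odd_tperm ab /=; case: (odd_perm s) => /= Ns.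
  by rewrite -[s](mulKg (tperm x y)) tpermV mulgA groupM // N2.
by rewrite mulgA groupM // N2.
Qed.

(** The product is the commutator of [tperm a b] and [g]. *)
Lemma tperm_mulJ_normal N g a b :
    (forall g s, perm_on S g -> s \in N -> s ^ g \in N) ->
    g \in N -> a \in S -> b \in S -> tperm a b * tperm (g a) (g b) \in N.
Proof.
move=> nN gN aS bS; rewrite -tpermJ -{1}(tpermV a b) -commgEl commgEr.
by rewrite groupM // nN ?groupV ?perm_on_tperm.
Qed.

(** The commutator of [tperm x z] and [g] is a 3-cycle on [x], [z] and [g x]. *)
Lemma even_perm_normal_fix N g x z :
    (forall g s, perm_on S g -> s \in N -> s ^ g \in N) ->
    g \in N -> perm_on S g -> x \in S -> z \in S -> g x != x -> g z = z ->
  forall s, perm_on S s -> ~~ odd_perm s -> s \in N.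
Proof.
move=> nN gN Sg xS zS gx gz.
have xz : x != z by apply: contraNneq gx => ->; rewrite gz.
have gxz : g x != z by rewrite -gz (inj_eq perm_inj).
apply: (even_perm_normal nN xS zS (z := g x)) => //.
- by rewrite (perm_closed _ Sg).
- by rewrite /= !inE negb_or xz eq_sym gx eq_sym gxz.
by rewrite (tpermC z) -{2}gz tperm_mulJ_normal.
Qed.

(** Commutators with [r] lead to a 3-cycle, hence to all even permutations of [S], except when [S]
    has two points or [r] is a double transposition of four points; the latter is even. *)
Lemma odd_normal_perm_on N r :
    (forall g s, perm_on S g -> s \in N -> s ^ g \in N) ->
    r \in N -> perm_on S r -> odd_perm r ->
  forall s, perm_on S s -> s \in N.
Proof.
move=> nN rN Sr odd_r.
suff even_N s : perm_on S s -> ~~ odd_perm s -> s \in N.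
  move=> s Ss; have [odd_s|] := boolP (odd_perm s); last exact: even_N.
  rewrite -[s](mulgKV r) groupM // even_N ?perm_onM ?perm_onV //.
  by rewrite odd_permM odd_permV odd_s odd_r.
have [x rx|fix_r] := pickP (fun x => r x != x); last first.
  case/negP: (negbT (odd_perm1 T)); rewrite -[1](_ : r = 1) //.
  by apply/permP => x; rewrite perm1; apply/eqP/negbFE/fix_r.
have xS : x \in S by apply: contraNT rx => /(out_perm Sr) ->.
have rxS : r x \in S by rewrite (perm_closed _ Sr).
have [rrx|rrx] := eqVneq (r (r x)) x; last first.
  apply: (even_perm_normal nN xS rxS (z := r (r x))).
  - by rewrite (perm_closed _ Sr).
  - by rewrite /= !inE negb_or eq_sym rx eq_sym rrx (inj_eq perm_inj) eq_sym rx.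
  exact: tperm_mulJ_normal.
have [z /andP[zS /andP[zx zrx]]|S2] :=
  pickP (fun z => (z \in S) && ((z != x) && (z != r x))); last first.
  have Stp a b : a \in S -> b \in S -> tperm a b \in [set 1; r].
    have rE : r = tperm x (r x).
      apply/permP => z; case: tpermP => [-> //|->//|/eqP zx /eqP zrx].
      apply/(out_perm Sr)/negP => zS; have := S2 z.
      by rewrite zS zx zrx.
    have SE z : z \in S -> z = x \/ z = r x.
      move=> zS; have := S2 z; rewrite zS /= => /negbT.
      by rewrite negb_and !negbK => /orP[] /eqP; [left|right].
    by move=> /SE[]-> /SE[]->; rewrite ?tperm1 ?(tpermC _ x) -?rE !inE eqxx ?orbT.
  move=> Ss _; move: s Ss; apply: perm_on_ind => [|a b s aS bS Ss sN]; first exact: group1.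
  by rewrite groupM //; have /set2P[] := Stp a b aS bS => ->.
have [rz|rz] := eqVneq (r z) z; first exact: (even_perm_normal_fix nN rN Sr xS zS).
have rzS : r z \in S by rewrite (perm_closed _ Sr).
have rzx : r z != x by rewrite -rrx (inj_eq perm_inj).
have rzrx : r z != r x by rewrite (inj_eq perm_inj).
have [e /and3P[eS ex /and3P[erx ez erz]]|S4] := pickP (fun e =>
  [&& e \in S, e != x & [&& e != r x, e != z & e != r z]]).
  (* A fifth point [e] is fixed by the double transposition [k], which moves [x]. *)
  pose k := tperm x z * tperm (r x) (r z).
  have kN : k \in N.
    exact: tperm_mulJ_normal.
  have Sk : perm_on S k by rewrite perm_onM ?perm_on_tperm.
  apply: (even_perm_normal_fix nN kN Sk xS eS).
    by rewrite permM tpermL tpermD // eq_sym.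
  by rewrite permM !tpermD // eq_sym.
have [rrz|rrz] := eqVneq (r (r z)) z; last first.
  apply: (even_perm_normal nN zS rzS (z := r (r z))).
  - by rewrite (perm_closed _ Sr).
  - by rewrite /= !inE negb_or eq_sym rz eq_sym rrz (inj_eq perm_inj) eq_sym rz.
  exact: tperm_mulJ_normal.
suff rE : r = tperm x (r x) * tperm z (r z).
  by move: odd_r; rewrite rE odd_permM !odd_tperm eq_sym rx eq_sym rz.
apply/permP => e; rewrite permM.
case: (tpermP x) => [->|->|/eqP ex /eqP erx].
- by rewrite tpermD // eq_sym.
- by rewrite rrx tpermD // eq_sym.
case: tpermP => [-> //|->|/eqP ez /eqP erz]; first by rewrite rrz.
by apply/(out_perm Sr)/negP => eS; have := S4 e; rewrite eS ex erx ez erz.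
Qed.

End SymmetricGroup.

(** * Goursat's argument for two symmetric groups *)

Section Goursat.
Variables (X Y : finType) (SX : {set X}) (SY : {set Y}).
Variable G : {group {perm X} * {perm Y}}.
Hypothesis surjX : forall l, perm_on SX l -> exists r, (l, r) \in G.
Hypothesis surjY : forall r, perm_on SY r -> exists l, (l, r) \in G.

Definition right_kernel : {set {perm Y}} := [set r | (1, r) \in G].

Fact right_kernel_group_set : group_set right_kernel.
Proof.
apply/group_setP; split=> [|r s]; rewrite !inE; first exact: group1.
by move=> Gr Gs; rewrite -[1]mulg1 (groupM Gr Gs).
Qed.
Canonical right_kernel_group := Group right_kernel_group_set.

Lemma right_kernel_normal g s :
  perm_on SY g -> s \in right_kernel -> s ^ g \in right_kernel.
Proof.
move=> /surjY[l Gl]; rewrite !inE => Gs; rewrite -(conj1g l).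
exact: (groupJ Gs Gl).
Qed.

(* If every [r] with [(1, r) \in G] were even, then [l |-> odd_perm r] would be
   a nontrivial character of the symmetric group on [SX], that is, the sign. *)
Lemma full_right_kernel p :
    (forall q, q \in G -> perm_on SX q.1 /\ perm_on SY q.2) ->
    p \in G -> odd_perm p.1 != odd_perm p.2 ->
  forall r, perm_on SY r -> r \in right_kernel.
Proof.
move=> supG Gp odd_p.
have [r /andP[Kr odd_r]|even_K] :=
    pickP (fun r => (r \in right_kernel) && odd_perm r).
  apply: (@odd_normal_perm_on _ SY [group of right_kernel] r) => //.
    exact: right_kernel_normal.
  by have [] := supG (1, r); rewrite // inE in Kr.
have sgnE l r r' : (l, r) \in G -> (l, r') \in G -> odd_perm r = odd_perm r'.
  move=> Gr Gr'; have: r^-1 * r' \in right_kernel.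
    by rewrite inE -[1](mulVg l) (groupM (groupVr Gr) Gr').
  move=> K; have := even_K (r^-1 * r'); rewrite K odd_permM odd_permV /=.
  by move/negbT; rewrite negb_add => /eqP.
have [[x y] /and3P[/= xS yS xy]|SX1] :=
    pickP (fun z => [&& z.1 \in SX, z.2 \in SX & z.1 != z.2]); last first.
  have p1 : p.1 = 1.
    have [Sp _] := supG _ Gp; apply: (perm_on_id Sp); rewrite leqNgt.
    apply/negP => /card_gt1P[x [y [xS yS xy]]].
    by have := SX1 (x, y); rewrite /= xS yS xy.
  have := even_K p.2; rewrite inE -{1}p1 -surjective_pairing Gp /=.
  by move: odd_p; rewrite p1 odd_perm1; case: odd_perm.
have [r0 Gr0] := surjX (perm_on_tperm xS yS).
(* Transpositions of [SX] are conjugate, so their partners all have the parity of [r0]. *)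
have oddE l : perm_on SX l ->
    forall r, (l, r) \in G -> odd_perm r = odd_perm l && odd_perm r0.
  move: l; apply: perm_on_ind => [r Gr|a b s aS bS Ss IHs r Gr].
    by have := even_K r; rewrite inE Gr odd_perm1.
  have [ab|ab] := eqVneq a b; first by move: Gr; rewrite ab tperm1 mul1g; apply: IHs.
  have [g [Sg gx gy]] := perm_on_2transitive xS yS aS bS xy ab.
  have [h Gh] := surjX Sg.
  have Gra : (tperm a b, r0 ^ h) \in G.
    by rewrite -gx -gy -tpermJ; apply: (groupJ Gr0 Gh).
  have := IHs ((r0 ^ h)^-1 * r).
  rewrite -[in (s, _)](mulKg (tperm a b) s) (groupM (groupVr Gra) Gr) => /(_ isT).
  rewrite !odd_permM odd_permV odd_permJ odd_tperm ab.
  by case: (odd_perm r) (odd_perm s) (odd_perm r0) => [] [] [].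
have [odd_r0|even_r0] := boolP (odd_perm r0).
  case/negP: odd_p; have [Sp _] := supG _ Gp.
  by rewrite (oddE p.1 Sp p.2) ?odd_r0 ?andbT -?surjective_pairing.
(* A trivial character makes every permutation of [SY] even, so [SY] has at most one point. *)
have even_SY r : perm_on SY r -> odd_perm r = false.
  move=> /surjY[l Gl]; have [Sl _] := supG _ Gl.
  by rewrite (oddE l Sl r Gl) (negbTE even_r0) andbF.
move=> r Sr; suff ->: r = 1 by exact: group1.
apply: (perm_on_id Sr); rewrite leqNgt; apply/negP => /card_gt1P[a [b [aS bS ab]]].
by have := even_SY _ (perm_on_tperm aS bS); rewrite odd_tperm ab.
Qed.
End Goursat.

(** * The transition permutations of one component *)

Definition rot_perm n : {perm 'I_n.+1} := perm (@ordS_inj n.+1).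

(* The state q_{n,i} is encoded as [i], so that c_n is [0], a_n is [2n - 1], and
   b_n is [2n]; the single state of B^(0) is [0].  In these coordinates the
   transition on 1 is a rotation, and the one on 0 swaps b_n and c_n after it. *)
Definition letter_perm n (y : bool) : {perm 'I_n.*2.+1} :=
  if y then rot_perm n.*2 else rot_perm n.*2 * tperm ord0 ord_max.

Definition flips n (q : 'I_n.*2.+1) : bool := (n == 0) || (q.+1 < n.*2).

(** A flipping state moves independently of the bit it reads, so its output bit may replace its
    input bit. This makes the dual action compatible with reversal of words. *)
Lemma letter_perm_flips n (q : 'I_n.*2.+1) y :
  letter_perm n (y (+) flips q) q = letter_perm n y q.
Proof.
have [fq|_] := boolP (flips q); last by rewrite addbF.
suff TE : letter_perm n false q = letter_perm n true q by case: y.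
rewrite /letter_perm /= permM ![rot_perm _ _]permE.
case/orP: fq => [/eqP n0|lt_q].
  by apply: val_inj; subst n; rewrite !ord1.
rewrite tpermD // -val_eqE /= modn_small ?ltnS 1?ltnW // eq_sym.
by rewrite neq_ltn lt_q.
Qed.

(** A rotation of odd order is even, so the sign is that of the transposition, which degenerates for
    [n = 0]. *)
Lemma odd_letter_perm n y : odd_perm (letter_perm n y) = ~~ y && (n != 0).
Proof.
have even_rot : odd_perm (rot_perm n.*2) = false.
  have iter_rot k (q : 'I_n.*2.+1) : val ((rot_perm n.*2 ^+ k) q) = (q + k) %% n.*2.+1.
    elim: k => [|k IHk]; first by rewrite expg0 perm1 addn0 modn_small.
    by rewrite expgSr permM permE /= IHk -addn1 modnDml addn1 addnS.
  have rot1 : rot_perm n.*2 ^+ n.*2.+1 = 1.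
    apply/permP => q; apply: val_inj.
    by rewrite iter_rot perm1 modnDr modn_small.
  have oddX k : odd_perm (rot_perm n.*2 ^+ k) = odd k && odd_perm (rot_perm n.*2).
    elim: k => [|k IHk]; first by rewrite expg0 odd_perm1.
    by rewrite expgS odd_permM IHk /=; case: (odd k) (odd_perm _) => [] [].
  by have := oddX n.*2.+1; rewrite rot1 odd_perm1 /= odd_double.
case: y; rewrite /= ?even_rot // odd_permM even_rot odd_tperm -val_eqE /=.
by rewrite eq_sym double_eq0.
Qed.

Lemma letter_perm_max n : letter_perm n false ord_max = ord_max.
Proof.
rewrite /letter_perm /= permM ![rot_perm _ _]permE.
by rewrite [ordS _](_ : _ = ord0) ?tpermL //; apply: val_inj; rewrite /= modnn.
Qed.

Lemma flips_max n : flips (@ord_max n.*2) = (n == 0).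
Proof. by rewrite /flips /= ltnNge leqnSn orbF. Qed.

Lemma addb_sum_const k b : \big[addb/false]_(i < k) b = odd k && b.
Proof.
elim: k => [|k IHk]; first by rewrite big_ord0.
by rewrite big_ord_recr /= IHk; case: (odd k); rewrite ?addbb.
Qed.

(** There are [2n - 1] flipping states, or one for [n = 0]: an odd number. *)
Lemma addb_sum_flips n : \big[addb/false]_(q : 'I_n.*2.+1) flips q = true.
Proof.
case: n => [|n]; first by rewrite big_ord1.
have -> : \big[addb/false]_(q : 'I_n.+1.*2.+1) flips q =
          \big[addb/false]_(q < n.*2.+3) (q.+1 < n.*2.+2) by [].
rewrite !big_ord_recr /= ltnn leqnn (ltnNge n.*2.+3) leqnSn !addbF.
rewrite (eq_bigr (fun=> true)) => [|i _]; first by rewrite addb_sum_const odd_double.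
by rewrite !ltnS ltnW.
Qed.

(* Words are read from right to left: [q :: w] stands for the composition of
   [q] with [w], so the head is the last letter to process the input. *)
Definition letter := {n : nat & 'I_n.*2.+1}.

Notation pack j := (Tagged (fun n => 'I_n.*2.+1) j).

(** * The dual action on words of states *)

Section DualWords.
Implicit Types (w v : seq letter) (xs ys : seq bool).

Definition parity w : bool := foldr (fun q b => flips (tagged q) (+) b) false w.

Definition letter_step y (q : letter) : letter :=
  Tagged (fun n => 'I_n.*2.+1) (letter_perm (tag q) y (tagged q)).

(** The letter [q] reads the bit that [w'] has already processed, hence the shift by [parity w']. *)
Fixpoint dual y w : seq letter :=
  if w is q :: w' then letter_step (y (+) parity w') q :: dual y w' else [::].

Fixpoint run xs w : seq letter :=
  if xs is x :: xs' then run xs' (dual x w) else w.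

Fixpoint outs xs w : seq bool :=
  if xs is x :: xs' then (x (+) parity w) :: outs xs' (dual x w) else [::].

Fixpoint label n xs : {perm 'I_n.*2.+1} :=
  if xs is x :: xs' then letter_perm n x * label n xs' else 1.

Lemma run_cat xs ys w : run (xs ++ ys) w = run ys (run xs w).
Proof. by elim: xs w => //= x xs IHxs w; rewrite IHxs. Qed.

Lemma outs_cat xs ys w : outs (xs ++ ys) w = outs xs w ++ outs ys (run xs w).
Proof. by elim: xs w => //= x xs IHxs w; rewrite IHxs. Qed.

Lemma label_cat n xs ys : label n (xs ++ ys) = label n xs * label n ys.
Proof. by elim: xs => [|x xs /= ->]; rewrite ?mul1g ?mulgA. Qed.

Lemma run_nil xs : run xs [::] = [::].
Proof. by elim: xs. Qed.

Lemma outs_nil xs : outs xs [::] = xs.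
Proof. by elim: xs => //= x xs ->; rewrite addbF. Qed.

Lemma outs_cons xs q w : outs xs (q :: w) = outs (outs xs w) [:: q].
Proof.
elim: xs q w => //= x xs IHxs q w; rewrite IHxs !addbF.
by congr (_ :: _); rewrite addbA addbAC.
Qed.

Lemma run_cons xs n (q : 'I_n.*2.+1) w :
  run xs (Tagged (fun n => 'I_n.*2.+1) q :: w) =
  Tagged (fun n => 'I_n.*2.+1) (label n (outs xs w) q) :: run xs w.
Proof.
elim: xs q w => [|x xs IHxs] q w /=; first by rewrite perm1.
by rewrite [letter_step _ _]/letter_step /= IHxs permM.
Qed.

Lemma parity_cat w v : parity (w ++ v) = parity w (+) parity v.
Proof. by elim: w => //= q w ->; rewrite addbA. Qed.

Lemma parity_rev w : parity (rev w) = parity w.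
Proof.
elim: w => //= q w IHw; rewrite rev_cons -cats1 parity_cat IHw /= addbF.
exact: addbC.
Qed.

Lemma dual_cat y w v : dual y (w ++ v) = dual (y (+) parity v) w ++ dual y v.
Proof.
elim: w => //= q w ->; rewrite parity_cat -addbA.
by congr (letter_step (y (+) _) q :: _); rewrite addbC.
Qed.

(** The reversed word, fed the output bit of [w], gives each letter its former output as input; by
    [letter_perm_flips] the letter makes the same move. *)
Lemma rev_dual y w : rev (dual y w) = dual (y (+) parity w) (rev w).
Proof.
elim: w y => //= q w IHw y; rewrite !rev_cons -!cats1 dual_cat /= IHw addbF.
rewrite -[in RHS]addbA (addbC (flips _)) -!addbA addbb addbF; congr (_ ++ [:: _]).
congr existT; rewrite -[LHS]letter_perm_flips; congr (letter_perm _ _ _).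
by rewrite -addbA (addbC (flips _)).
Qed.

Lemma rev_run xs w : rev (run xs w) = run (outs xs w) (rev w).
Proof. by elim: xs w => //= x xs IHxs w; rewrite IHxs rev_dual. Qed.

(** Each single letter acts as an involution, so reversal inverts the transformation. *)
Lemma outs_rev xs w : outs (outs xs w) (rev w) = xs.
Proof.
elim: xs w => //= x xs IHxs w; rewrite -rev_dual IHxs parity_rev.
by rewrite -addbA addbb addbF.
Qed.

Definition nonrep w : bool := sorted (fun p q => p != q) w.

Arguments nonrep : simpl never.

Definition pattern w : seq nat := map tag w.

Lemma nonrep_rev w : nonrep (rev w) = nonrep w.
Proof. by rewrite /nonrep rev_sorted; apply: eq_sorted => p q; rewrite eq_sym. Qed.

Lemma pattern_rev w : pattern (rev w) = rev (pattern w).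
Proof. exact: map_rev. Qed.

Lemma pattern_dual y w : pattern (dual y w) = pattern w.
Proof. by elim: w => //= q w ->. Qed.

Lemma size_pattern w : size (pattern w) = size w.
Proof. exact: size_map. Qed.

Lemma pattern_run xs w : pattern (run xs w) = pattern w.
Proof. by elim: xs w => //= x xs IHxs w; rewrite IHxs pattern_dual. Qed.

(* The head of [w] moves as if it were a new letter put in front of [w]. *)
Lemma letter_step_flips y (q : letter) :
  letter_step (y (+) flips (tagged q)) q = letter_step y q.
Proof. by congr existT; apply: letter_perm_flips. Qed.

Lemma letter_step_inj y : injective (letter_step y).
Proof.
move=> [n q] [m p] /eqP E; have /eqP /= nm : n == m.
  by move: E; rewrite -tag_eqE /tag_eq /= => /andP[].
by subst m; move: E; rewrite eq_Tagged /= (inj_eq perm_inj) => /eqP ->.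
Qed.

Lemma nonrep_cons q w :
  nonrep (q :: w) = (ohead w != Some q) && nonrep w.
Proof. by case: w => //= p w; rewrite /nonrep /= (inj_eq Some_inj) eq_sym. Qed.

(** Two adjacent letters move by the same injective step, since the right one may use its output
    bit, which is the input bit of the left one. *)
Lemma nonrep_dual y w : nonrep (dual y w) = nonrep w.
Proof.
elim: w => // q w IHw; rewrite /= !nonrep_cons IHw; congr (_ && _).
case: w {IHw} => //= p w; rewrite !(inj_eq Some_inj) -letter_step_flips -addbA.
by rewrite (addbC (parity w)) (inj_eq (@letter_step_inj _)).
Qed.

Lemma nonrep_run xs w : nonrep (run xs w) = nonrep w.
Proof. by elim: xs w => //= x xs IHxs w; rewrite IHxs nonrep_dual. Qed.

Definition free_letters w n : {set 'I_n.*2.+1} := [set j | ohead w != Some (pack j)].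

(** The label of a loop always fixes the head of [w], so these are the most permutations that loops
    can induce. *)
Definition full w n : Prop :=
  forall r, perm_on (free_letters w n) r ->
  exists2 xs, run xs w = w & label n (outs xs w) = r.

Lemma label_head xs n (h : 'I_n.*2.+1) w :
  label n (outs xs (pack h :: w)) h = label n (outs xs w) h.
Proof.
elim: xs h w => //= x xs IHxs h w; rewrite !permM [letter_step _ _]/letter_step.
have <- : letter_perm n (x (+) (flips h (+) parity w)) h =
          letter_perm n (x (+) parity w) h.
  by rewrite (addbC (flips h)) addbA letter_perm_flips.
exact: IHxs.
Qed.

Lemma loop_label_on xs w n :
  run xs w = w -> perm_on (free_letters w n) (label n (outs xs w)).
Proof.
case: w => [|q w] loop; apply/subsetP => j; rewrite !inE; apply: contraNN => //=.
rewrite (inj_eq Some_inj) => /eqP qj; rewrite qj label_head.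
have := congr1 ohead loop; rewrite qj run_cons => /eqP.
by rewrite (inj_eq Some_inj) eq_Tagged.
Qed.

Lemma rev_loop xs w : run xs w = w -> run (outs xs w) (rev w) = rev w.
Proof. by rewrite -rev_run => ->. Qed.

(** A letter behind [w] reads the input first. Reversal puts it in front, where it is moved by
    [label (tag q) xs], because [rev w] turns [outs xs w] back into [xs]. *)
Lemma rcons_loop xs w (q : letter) :
    run xs w = w -> label (tag q) xs (tagged q) = tagged q ->
  exists2 ys, run ys (rcons w q) = rcons w q & outs ys (rcons w q) = outs xs w.
Proof.
case: q => n q /= loop fix_q; set zs := outs xs w.
have Ezs : run zs (pack q :: rev w) = pack q :: rev w.
  by rewrite run_cons rev_loop // outs_rev fix_q.
have -> : rcons w (pack q) = rev (pack q :: rev w) by rewrite rev_cons revK.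
by exists (outs zs (pack q :: rev w)); rewrite ?outs_rev // -rev_run Ezs.
Qed.

(** * Loops acting on both ends of a word *)

Section LoopGroup.
Variables (w : seq letter) (i j : nat).

(* A loop at [w] acts on a letter put behind [w] and on one put before it. *)
Definition loops : {set {perm 'I_i.*2.+1} * {perm 'I_j.*2.+1}} :=
  [set p | `[< exists xs, [/\ run xs w = w, label i xs = p.1
                             & label j (outs xs w) = p.2] >]].

Fact loops_group_set : group_set loops.
Proof.
apply/group_setP; split=> [|p q]; first by rewrite inE; apply/asboolP; exists [::].
rewrite !inE => /asboolP[xs [loopx px qx]] /asboolP[ys [loopy py qy]].
apply/asboolP; exists (xs ++ ys).
by rewrite run_cat loopx outs_cat loopx !label_cat px py qx qy.
Qed.
Canonical loops_group := Group loops_group_set.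

Lemma mem_loops p :
  reflect (exists xs, [/\ run xs w = w, label i xs = p.1
                       & label j (outs xs w) = p.2]) (p \in loops).
Proof. by rewrite inE; apply: asboolP. Qed.

Lemma loops_perm_on p :
  p \in loops -> perm_on (free_letters (rev w) i) p.1 /\ perm_on (free_letters w j) p.2.
Proof.
case/mem_loops => xs [loop <- <-]; split; last exact: loop_label_on.
by rewrite -(outs_rev xs w) loop_label_on // rev_loop.
Qed.

Lemma loops_left l :
  full (rev w) i -> perm_on (free_letters (rev w) i) l -> exists r, (l, r) \in loops.
Proof.
move=> fw /fw[ys loop ly]; exists (label j ys).
apply/mem_loops; exists (outs ys (rev w)).
have := outs_rev ys (rev w); have := rev_loop loop; rewrite revK => loop' outsE.
by rewrite loop' outsE.
Qed.

Lemma loops_right r :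
  full w j -> perm_on (free_letters w j) r -> exists l, (l, r) \in loops.
Proof.
by move=> fw /fw[ys loop ly]; exists (label i ys); apply/mem_loops; exists ys.
Qed.

End LoopGroup.

(** * Fullness and transitivity *)

Definition full_upto k : Prop :=
  forall w n, nonrep w -> size w <= k -> full w n.

(** A run first carries the tail of [w] to that of [v]; a loop at this tail then corrects the head
    by a transposition. Fullness is needed only for tails, whence the bound [k.+1]. *)
Lemma run_transitive k w v :
    full_upto k -> size w <= k.+1 -> nonrep w -> nonrep v ->
    pattern w = pattern v ->
  exists xs, run xs w = v.
Proof.
move=> fullk; elim: w v => [|[n a] w IHw] [|[m b] v] //=; first by exists [::].
rewrite ltnS !nonrep_cons => le_k /andP[aw nw] /andP[bv nv] [nm wv]; subst m.
have [xs xsE] := IHw v (leqW le_k) nw nv wv.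
pose a1 := label n (outs xs w) a.
have a1v : nonrep (pack a1 :: v).
  by rewrite -xsE -run_cons nonrep_run nonrep_cons aw.
have [||ys ysE lE] := fullk v n nv _ (tperm a1 b).
- by rewrite -(size_pattern v) -wv size_pattern.
- apply: perm_on_tperm; rewrite inE //.
  by move: a1v; rewrite nonrep_cons => /andP[].
exists (xs ++ ys); rewrite run_cat run_cons xsE run_cons ysE -/a1 lE.
by rewrite tpermL.
Qed.

(** * Fullness for words of length zero and one *)

Lemma full_nil n : full [::] n.
Proof.
move=> r _; suff [xs] : exists xs, label n xs = r.
  by move=> lE; exists xs; rewrite ?run_nil ?outs_nil.
case: n r => [|n] r.
  by exists [::]; apply/permP => q; rewrite !ord1.
pose L := [set s | `[< exists xs, label n.+1 xs = s >]].
have L_group : group_set L.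
  apply/group_setP; split=> [|s t]; first by rewrite inE; apply/asboolP; exists [::].
  rewrite !inE => /asboolP[xs <-] /asboolP[ys <-]; apply/asboolP.
  by exists (xs ++ ys); rewrite label_cat.
have Lx y : letter_perm n.+1 y \in Group L_group.
  by rewrite inE; apply/asboolP; exists [:: y]; rewrite /= mulg1.
suff: r \in Group L_group by rewrite inE => /asboolP.
have : r \in [set: 'S_(n.*2.+1).+2] by rewrite inE.
(* The input letters yield a full cycle and the transposition of two cyclically adjacent points,
   which generate the symmetric group. *)
rewrite -(@gen_tpermn_circular_shift _ 0%R ord_max).
  apply/subsetP; rewrite gen_subG; apply/subsetP => s /set2P[] ->.
    have := groupM (groupVr (Lx true)) (Lx false).
    by rewrite /letter_perm mulKg.
  suff -> : perm (GRing.addrI (1%R : 'I_(n.*2.+1).+2)) = letter_perm n.+1 true by apply: Lx.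
  apply/permP => q; rewrite !permE.
  exact: (@add_1_Zp n.*2.+3).
by rewrite GRing.subr0 coprimeSn.
Qed.

Lemma label_nseq_false n k (q : 'I_n.*2.+1) :
  q < n.*2 -> val (label n (nseq k false) q) = (q + k) %% n.*2.
Proof.
elim: k q => [|k IHk] q lt_q; first by rewrite perm1 addn0 modn_small.
rewrite [nseq _ _]/= [label _ _]/= permM.
have stepE : val (letter_perm n false q) = q.+1 %% n.*2.
  rewrite /letter_perm permM [rot_perm _ _]permE.
  have [lt_q1|] := ltnP q.+1 n.*2.
    have qE : val (ordS q) = q.+1 by rewrite /= modn_small // ltnS.
    rewrite tpermD; first by rewrite qE modn_small.
      by rewrite -val_eqE qE.
    by rewrite -val_eqE qE /= eq_sym neq_ltn lt_q1.
  move=> le_q; have q1 : q.+1 = n.*2 by apply/eqP; rewrite eqn_leq le_q lt_q.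
  rewrite [ordS q](_ : _ = ord_max) ?tpermR /= ?q1 ?modnn //.
  by apply: val_inj; rewrite /= q1 modn_small.
have n_gt0 : 0 < n.*2 by apply: leq_ltn_trans lt_q.
by rewrite IHk stepE ?ltn_pmod // modnDml addSnnS.
Qed.

Lemma label_nseq_false_max n k : label n (nseq k false) ord_max = ord_max.
Proof. by elim: k => [|k /= IHk]; rewrite ?perm1 // permM letter_perm_max. Qed.

Lemma card_lt_exists_notin (T : finType) (A : {set T}) :
  #|A| < #|T| -> exists x, x \notin A.
Proof.
move=> lt_A; have [x xA|AT] := pickP (fun x => x \notin A); first by exists x.
move: lt_A; rewrite ltnNge subset_leq_card //.
by apply/subsetP => x _; apply/negbNE/negbT/AT.
Qed.

Lemma ord_avoid2 n (a b : 'I_n.+3) : exists e, (e != a) && (e != b).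
Proof.
have [|e] := @card_lt_exists_notin _ [set a; b].
  by rewrite cards2 card_ord; case: (a != b).
by rewrite !inE negb_or; exists e.
Qed.

Lemma full_one q j : full [:: q] j.
Proof.
case: q => i q r Sr.
suff [xs fix_q lr] : exists2 xs, label i xs q = q & label j xs = r.
  have [ys loop outsE] := @rcons_loop xs [::] (pack q) (run_nil xs) fix_q.
  by exists ys => //; rewrite outsE outs_nil.
have fullT n (s : 'S_n.*2.+1) : perm_on (free_letters [::] n) s by apply/subsetP=> x _; rewrite inE.
have [ij|ij] := eqVneq i j.
  subst j; have [xs _ lr] := full_nil (fullT _ r).
  exists xs; rewrite outs_nil in lr; rewrite // lr (out_perm Sr) //.
  by rewrite inE /= eqxx.
case: i q Sr ij => [|i] q Sr ij.
  have [xs _ lr] := full_nil (fullT _ r); rewrite outs_nil in lr.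
  by exists xs; rewrite // !ord1.
case: j r Sr ij => [|j] r Sr ij.
  by exists [::]; rewrite ?perm1 //; apply/permP => x; rewrite !ord1.
suff [l Glr lq] : exists2 l, (l, r) \in loops [::] i.+1 j.+1 & l q = q.
  by case/mem_loops: Glr => xs [_ /= lE rE]; exists xs; rewrite ?lE // -rE outs_nil.
have swapG m n p : (p \in loops [::] m n) -> ((p.2, p.1) \in loops [::] n m).
  case/mem_loops=> xs; rewrite outs_nil => -[_ <- <-].
  by apply/mem_loops; exists xs; rewrite outs_nil run_nil.
have leftG m n l : exists s, (l, s) \in loops [::] m n.
  by apply: loops_left; [apply: full_nil | apply: fullT].
have rightG m n s : exists l, (l, s) \in loops [::] m n.
  by apply: loops_right; [apply: full_nil | apply: fullT].
(* The power of the letter 0 that is trivial on the smaller component moves [ord0] and fixes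
   [ord_max] in the larger one. *)
have evenK m n (s : 'S_n.+1.*2.+1) : m < n -> ~~ odd_perm s ->
    (1, s) \in loops [::] m.+1 n.+1.
  move=> lt_mn even_s.
  pose g := label n.+1 (nseq m.+1.*2 false).
  suff: s \in right_kernel (loops_group [::] m.+1 n.+1) by rewrite inE.
  have normK g' s' := @right_kernel_normal _ _ _ (loops_group [::] m.+1 n.+1)
    (fun r _ => rightG m.+1 n.+1 r) g' s'.
  apply: (@even_perm_normal_fix _ (free_letters [::] n.+1) [group of right_kernel _] g ord0 ord_max).
  - exact: normK.
  - rewrite inE; apply/mem_loops; exists (nseq m.+1.*2 false).
    rewrite run_nil outs_nil; split=> //; apply/permP => x; rewrite perm1.
    apply: val_inj; have [lt_x|le_x] := ltnP x m.+1.*2.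
      by rewrite label_nseq_false // modnDr modn_small.
    have -> : x = ord_max by apply: val_inj; apply/eqP; rewrite eqn_leq le_x -ltnS ltn_ord.
    by rewrite label_nseq_false_max.
  - exact: fullT.
  - by rewrite inE.
  - by rewrite inE.
  - rewrite -val_eqE label_nseq_false // add0n modn_small ?double_eq0 //.
    by rewrite ltn_double.
  - exact: label_nseq_false_max.
  - exact: fullT.
  - exact: even_s.
have [lt_ij|lt_ji] : i < j \/ j < i.
  by apply/orP; rewrite -neq_ltn; apply: contraNneq ij => ->.
  have [even_r|odd_r] := boolP (~~ odd_perm r).
    by exists 1; rewrite ?perm1 ?evenK.
  pose x0 := (@ord0 i.+1.*2, @ord0 j.+1.*2); pose x1 := (@ord_max i.+1.*2, @ord_max j.+1.*2).
  have Gt : (tperm x0.1 x1.1, tperm x0.2 x1.2) \in loops_group [::] i.+1 j.+1.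
    have GT y : (letter_perm i.+1 y, letter_perm j.+1 y) \in loops_group [::] i.+1 j.+1.
      by apply/mem_loops; exists [:: y]; rewrite /= !mulg1 addbF.
    suff -> : (tperm x0.1 x1.1, tperm x0.2 x1.2) =
              (letter_perm i.+1 true, letter_perm j.+1 true)^-1 *
              (letter_perm i.+1 false, letter_perm j.+1 false).
      by rewrite groupM ?groupV.
    by congr pair; rewrite /letter_perm /= mulKg.
  (* Conjugation by [tperm q e], with [e] outside the transposed pair, moves the left transposition
     off [q] and keeps the right component odd. *)
  have [e /andP[e0 e1]] := @ord_avoid2 i.*2 x0.1 x1.1.
  have [s Gs] := leftG i.+1 j.+1 (tperm q e).
  have Gts := groupJ Gt Gs.
  exists (tperm x0.1 x1.1 ^ tperm q e).
    set t := tperm x0.2 x1.2 ^ s.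
    have K : (1, r * t^-1) \in loops_group [::] i.+1 j.+1.
      apply: evenK => //; rewrite odd_permM odd_permV odd_permJ odd_tperm.
      by move: odd_r; rewrite negbK => ->.
    by rewrite -[r](mulgKV t) -[_ ^ _]mul1g; apply: (groupM K Gts).
  have fix_q x : x != e -> tperm q e x != q.
    by move=> xe; rewrite -[X in _ != X](tpermR q e) (inj_eq perm_inj).
  by rewrite tpermJ; apply: tpermD; apply: fix_q; rewrite eq_sym.
have [l Gl] := rightG i.+1 j.+1 r.
have [lq|lq] := eqVneq (l q) q; first by exists l.
have [e /andP[eq el]] := @ord_avoid2 i.*2 q (l q).
(* An even permutation of the larger component that sends [l q] back to [q]. *)
pose m := tperm (l q) e * tperm e q.
exists (l * m).
  have K : (m, 1) \in loops_group [::] i.+1 j.+1.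
    apply: (swapG _ _ (1, m)); apply: evenK => //.
    by rewrite /m odd_permM !odd_tperm eq eq_sym el.
  by rewrite -[r]mulg1; apply: (groupM Gl K).
by rewrite !permM tpermL tpermL.
Qed.

(** * Coboundaries on words and summation over the first letter *)

Definition head_flips w : bool := if w is q :: _ then flips (tagged q) else false.

(** [g] is the coboundary of [X] along the dual action on the non-repeating words of pattern [p]. *)
Definition drift (p : seq nat) (g : bool -> seq letter -> bool)
    (X : seq letter -> bool) : Prop :=
  forall y w, nonrep w -> pattern w = p -> X (dual y w) = X w (+) g y w.

Lemma drift_rev p X :
  drift p (fun _ w => ~~ head_flips w) X ->
  drift (rev p) (fun _ w => ~~ head_flips (rev w)) (X \o rev).
Proof.
move=> dX y w nw wp; rewrite /= rev_dual dX ?nonrep_rev //.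
by rewrite pattern_rev wp revK.
Qed.

Definition sum_other phi (h : letter) w : bool :=
  \big[addb/false]_(q : 'I_(tag h).*2.+1 | q != tagged h) phi (pack q :: w).

(** Reindex by the letter step. The constant [b] occurs an even number of times and cancels; the
    flips of all letters sum to [true], so those of the letters other than [h] sum to
    [~~ flips (tagged h)]. *)
Lemma sum_other_dual (phi : seq letter -> bool) b y (h : letter) w :
    (forall q : 'I_(tag h).*2.+1, q != tagged h ->
       phi (dual y (pack q :: w)) = phi (pack q :: w) (+) flips q (+) b) ->
  sum_other phi (letter_step (y (+) parity w) h) (dual y w) =
  sum_other phi h w (+) ~~ flips (tagged h).
Proof.
case: h => n h /= phiE; rewrite /sum_other /=.
rewrite (reindex_inj (@perm_inj _ (letter_perm n (y (+) parity w)))) /=.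
under eq_bigl => q do rewrite (inj_eq perm_inj).
under eq_bigr => q qh do rewrite -[pack _ :: _]/(dual y (pack q :: w)) phiE // -addbA.
rewrite big_split /=; congr (_ (+) _).
have := congr2 addb (addb_sum_flips n) (addb_sum_const n.*2.+1 b).
rewrite -big_split (bigD1 h) //= odd_double /=.
move: (\big[_/_]_(_ | _) _) => x.
by case: (flips h); case: b {phiE}; case: x.
Qed.

(** Sum over the first letter. If [p] begins with [i], the head of the word is the excluded letter;
    otherwise an auxiliary letter of component [i] is put in front and excluded. Either way [omega]
    cancels. *)
Lemma flips_drift_head i p phi omega :
    (forall y q w, nonrep (q :: w) -> tag q = i -> pattern w = p ->
       phi (dual y (q :: w)) = phi (q :: w) (+) flips (tagged q) (+) omega y w) ->
  exists p' X, [/\ p' = i :: p \/ p' = p, ohead p' = Some i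
                & drift p' (fun _ w => ~~ head_flips w) X].
Proof.
move=> phiE; have [ip|ip] := eqVneq (ohead p) (Some i).
  exists p, (fun w => if w is h :: _ then sum_other phi h w else false).
  split=> //; [by right | move=> y [|h w] nw wp]; first by rewrite -wp in ip.
  rewrite -(@sum_other_dual _ (omega y (h :: w)) y) => [|q qh].
    by rewrite /= (addbC (flips _)) addbA letter_step_flips.
  have hi : tag h = i by move: ip; rewrite -wp => -[].
  apply: phiE => //; rewrite nonrep_cons nw andbT /=.
  by case: h {nw wp hi} q qh => n h q /= qh; rewrite (inj_eq Some_inj) eq_Tagged eq_sym.
exists (i :: p), (fun w => if w is h :: w' then sum_other phi h w' else false).
split=> //; [by left | move=> y [|h w] // nw [hi wp]].
apply: (@sum_other_dual _ (omega y w) y) => q qh.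
apply: phiE => //; move: nw; rewrite !nonrep_cons => /andP[_ ->]; rewrite andbT.
apply: contraNneq ip; case: w wp => //= g w <- [->] /=.
by rewrite -hi.
Qed.

Lemma head_flips_rev_cons q w : w != [::] -> head_flips (rev (q :: w)) = head_flips (rev w).
Proof. by case/lastP: w => // w p _; rewrite rev_cons rev_rcons. Qed.

Lemma drift_run p g X xs w v :
    drift p g X -> nonrep w -> nonrep v -> pattern w = p -> pattern v = p ->
    (forall y xs', g y (run xs' w) = g y (run xs' v)) ->
  X (run xs w) (+) X (run xs v) = X w (+) X v.
Proof.
move=> dX; elim: xs w v => //= x xs IHxs w v nw nv wp vp gE.
rewrite IHxs ?nonrep_dual ?pattern_dual // => [|y xs']; last exact: (gE y (x :: xs')).
rewrite !dX // (gE x [::]).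
by case: (X w) (X v) (g _ _) => [] [] [].
Qed.

Lemma extension_exists k (q : letter) w v :
    full_upto k -> size w <= k.+1 -> nonrep (q :: w) -> nonrep v ->
    pattern w = pattern v ->
  exists a : 'I_(tag q).*2.+1, nonrep (pack a :: v).
Proof.
case: q => n q fullk le_k nqw nv wv.
have nw : nonrep w by move: nqw; rewrite nonrep_cons => /andP[].
have [xs xsE] := run_transitive fullk le_k nw nv wv.
by exists (label n (outs xs w) q); rewrite -xsE -run_cons nonrep_run.
Qed.

(** On three letters [letter_perm 1 false] is a reflection, which reverses the cyclic order. *)
Lemma rot_perm2_reflect (z : 'I_1.*2.+1) :
  [/\ rot_perm 1.*2 z != z, letter_perm 1 false (rot_perm 1.*2 z) != letter_perm 1 false z,
      rot_perm 1.*2 (letter_perm 1 false z) != letter_perm 1 false z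
    & letter_perm 1 false (rot_perm 1.*2 z) != rot_perm 1.*2 (letter_perm 1 false z)].
Proof.
rewrite /letter_perm !permM ![rot_perm _ _]permE ![tperm _ _ _]permE.
by case: z => [[|[|[|]]]].
Qed.

(** * Peeling the first letter off a drift that depends on the last letter *)

Section LastFlipsDrift.
Variables (k i n : nat) (p : seq nat) (X : seq letter -> bool).
Hypothesis fullk : full_upto k.
Hypothesis le_k : size (i :: p) <= k.
Let p' := rcons p n.+1.
Hypothesis dX : drift (i :: p') (fun _ w => ~~ head_flips (rev w)) X.

Let word w := nonrep w /\ pattern w = p'.

Let word_nil w : word w -> w != [::].
Proof. by case=> _; case: w => //; rewrite /p'; case: p. Qed.

Let size_word w : word w -> size w <= k.
Proof. by case=> _ wp; rewrite -(size_pattern w) wp size_rcons. Qed.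

Let word_dual y w : word w -> word (dual y w).
Proof. by case=> nw wp; split; rewrite ?nonrep_dual ?pattern_dual. Qed.

Let dX_cons y (a : 'I_i.*2.+1) w :
  word w -> nonrep (pack a :: w) ->
  X (dual y (pack a :: w)) = X (pack a :: w) (+) ~~ head_flips (rev w).
Proof.
move=> ww na; rewrite dX //=; last by case: ww => _ ->.
by rewrite head_flips_rev_cons ?word_nil.
Qed.

Lemma last_flips_drift_descend w0 :
    nonrep w0 -> pattern w0 = i :: p' ->
    (forall (a b : 'I_i.*2.+1) w, word w ->
       nonrep (pack a :: w) -> nonrep (pack b :: w) ->
       X (pack a :: w) = X (pack b :: w)) ->
  exists X', drift p' (fun _ w => ~~ head_flips (rev w)) X'.
Proof.
move=> nw0 w0p Xconst.
exists (fun w => if [pick a : 'I_i.*2.+1 | nonrep (pack a :: w)] is Some a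
                 then X (pack a :: w) else false) => y w nw wp.
have ww : word w by [].
have ext v : word v -> exists a : 'I_i.*2.+1, nonrep (pack a :: v).
  case=> nv vp; case: w0 nw0 w0p => // -[j q0] w0' nw0 /= [ji w0p]; subst j.
  apply: (extension_exists (q := pack q0) fullk _ nw0 nv); last by rewrite w0p vp.
  by rewrite -(size_pattern w0') w0p /p' size_rcons ltnW.
case: pickP => [b nb|no_b]; last first.
  by have [b] := ext _ (word_dual y ww); rewrite no_b.
case: pickP => [a na|no_a]; last by have [a] := ext _ ww; rewrite no_a.
rewrite -(dX_cons y) //; apply: Xconst => //; first exact: word_dual.
by rewrite -[_ :: _]/(dual y (pack a :: w)) nonrep_dual.
Qed.

Section NonConstant.
Variables (w1 : seq letter) (a1 b1 : 'I_i.*2.+1).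
Hypotheses (w1w : word w1) (na1 : nonrep (pack a1 :: w1)).
Hypotheses (nb1 : nonrep (pack b1 :: w1)).
Hypothesis Xab1 : X (pack a1 :: w1) != X (pack b1 :: w1).

(** The drift sees only the last letter, which the two words share, so the difference of [X] is
    constant along runs; two-fold transitivity on the first letter carries the pair [a], [b] to
    [a1], [b1]. *)
Lemma last_flips_drift_separates (a b : 'I_i.*2.+1) w :
    word w -> nonrep (pack a :: w) -> nonrep (pack b :: w) -> a != b ->
  X (pack a :: w) (+) X (pack b :: w) = true.
Proof.
move=> ww na nb ab; have [nw wp] := ww; have [nw1 w1p] := w1w.
have [xs xsE] := run_transitive fullk (leqW (size_word ww)) nw nw1 (etrans wp (esym w1p)).
pose g := label i (outs xs w).
have freeE (c : 'I_i.*2.+1) : nonrep (pack c :: w1) -> c \in free_letters w1 i.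
  by rewrite nonrep_cons inE => /andP[].
have ng (c : 'I_i.*2.+1) : nonrep (pack c :: w) -> g c \in free_letters w1 i.
  by move=> nc; apply: freeE; rewrite -xsE -run_cons nonrep_run.
have ab1 : a1 != b1 by apply: contraNneq Xab1 => ->.
have [|s [Ss sa sb]] := @perm_on_2transitive _ (free_letters w1 i) (g a) (g b) a1 b1
    (ng a na) (ng b nb) (freeE _ na1) (freeE _ nb1) _ ab1.
  by rewrite (inj_eq perm_inj).
have [ys ysE lE] := fullk nw1 (size_word w1w) Ss.
have runE (c : 'I_i.*2.+1) : run (xs ++ ys) (pack c :: w) = pack (s (g c)) :: w1.
  by rewrite run_cat run_cons xsE run_cons ysE lE.
have := @drift_run _ _ _ (xs ++ ys) _ _ dX na nb.
rewrite !runE sa sb /= wp => /(_ erefl erefl) <-.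
  by move: Xab1; case: (X _) (X _) => [] [].
move=> y zs; congr (~~ _); rewrite !run_cons !head_flips_rev_cons //.
all: by rewrite -size_eq0 -(size_pattern (run _ _)) pattern_run wp /p' size_rcons.
Qed.

(** A Boolean function cannot separate three letters pairwise, so just two letters may precede [w1].
    Their number is [2i + 1], or [2i] when [w1] begins in component [i]. *)
Lemma last_flips_drift_one : i = 1%N /\ ohead p' = Some 1%N.
Proof.
have [nw1 w1p] := w1w; have ab1 : a1 != b1 by apply: contraNneq Xab1 => ->.
have only2 c : nonrep (pack c :: w1) -> c \in [set a1; b1].
  move=> nc; rewrite !inE -[_ || _]negbK negb_or; apply/negP => /andP[ca cb].
  have := last_flips_drift_separates w1w nc na1 ca.
  have := last_flips_drift_separates w1w nc nb1 cb.
  by move: Xab1; case: (X _) (X _) (X _) => [] [] [].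
have i_gt0 : 0 < i.
  by case: i a1 b1 ab1 => // a b; rewrite !ord1.
case: w1 w1w nw1 w1p only2 => [|[j h] w2] w1w' nw1 w1p only2.
  by have := word_nil w1w'.
have [ji|ji] := eqVneq j i; last first.
  have [|c] := @card_lt_exists_notin _ [set a1; b1].
    by rewrite cards2 ab1 card_ord ltnS; case: i i_gt0 => // i' _; rewrite doubleS.
  case/negP; apply: only2; rewrite nonrep_cons nw1 andbT /= (inj_eq Some_inj).
  by apply: contraNneq ji => /(congr1 tag) /= ->.
subst j; have [i1|i1] := eqVneq i 1%N; first by rewrite -w1p /= i1.
have [|c] := @card_lt_exists_notin _ (h |: [set a1; b1]).
  rewrite cardsU1 cards2 ab1 card_ord.
  apply: (@leq_ltn_trans 3); first by case: (h \in _).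
  by case: i i_gt0 i1 => [|[|i']] // _ _; rewrite !doubleS.
rewrite in_setU1 negb_or => /andP[ch] /negP[]; apply: only2.
by rewrite nonrep_cons nw1 andbT /= (inj_eq Some_inj) eq_Tagged eq_sym.
Qed.
End NonConstant.
End LastFlipsDrift.

Definition oriented_value (X : seq letter -> bool) w : bool :=
  if w is z :: _ then X (Tagged (fun n => 'I_n.*2.+1) (rot_perm _ (tagged z)) :: w)
  else false.

(* If [X] separates the two letters of ['I_3] that may precede [z :: w], then
   the one that follows [z] in the cyclic order changes its role whenever the
   reflection [letter_perm 1 false] is applied. *)
Lemma oriented_value_dual (X : seq letter -> bool) b y (z : 'I_1.*2.+1) w :
    (forall a c : 'I_1.*2.+1,
       nonrep (pack a :: dual y (pack z :: w)) ->
       nonrep (pack c :: dual y (pack z :: w)) -> a != c ->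
       X (pack a :: dual y (pack z :: w)) (+) X (pack c :: dual y (pack z :: w))) ->
    nonrep (pack z :: w) ->
    (forall a : 'I_1.*2.+1, nonrep (pack a :: pack z :: w) ->
       X (dual y (pack a :: pack z :: w)) = X (pack a :: pack z :: w) (+) b) ->
  oriented_value X (dual y (pack z :: w)) =
  oriented_value X (pack z :: w) (+) b (+) ~~ (y (+) parity (pack z :: w)).
Proof.
move=> sepX nzw dXz.
have [rz frz rfz frz'] := rot_perm2_reflect z.
have nrz : nonrep (pack (rot_perm 1.*2 z) :: pack z :: w).
  by rewrite nonrep_cons nzw andbT /= (inj_eq Some_inj) eq_Tagged eq_sym.
have ndual (a : 'I_1.*2.+1) : a != letter_perm 1 (y (+) parity w) z ->
    nonrep (pack a :: dual y (pack z :: w)).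
  move=> az; rewrite nonrep_cons nonrep_dual nzw andbT /= (inj_eq Some_inj).
  by rewrite eq_Tagged eq_sym.
rewrite [oriented_value X (pack z :: w)]/= -(dXz _ nrz).
have stepE : letter_perm 1 (y (+) parity (pack z :: w)) z = letter_perm 1 (y (+) parity w) z.
  by rewrite /= (addbC (flips z)) addbA letter_perm_flips.
rewrite -[dual y (pack (rot_perm 1.*2 z) :: _)]/(
  pack (letter_perm 1 (y (+) parity (pack z :: w)) (rot_perm 1.*2 z)) :: dual y (pack z :: w)).
have -> : oriented_value X (dual y (pack z :: w)) =
    X (pack (rot_perm 1.*2 (letter_perm 1 (y (+) parity w) z)) :: dual y (pack z :: w)).
  by [].
rewrite -stepE.
case yw: (y (+) parity _); first by rewrite addbF.
rewrite -stepE yw in ndual.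
have := sepX _ _ (ndual _ frz) (ndual _ rfz) frz'.
by case: (X _) (X _) => [] [].
Qed.

(** Induction on [size p]. If [X] ignores the first letter, it descends to shorter words. Otherwise
    the pattern begins with two ones, and [oriented_value] gives a function on the tails; unless
    these are single letters, its drift contains the flips of their first letter, and summing and
    reversing leads back to a shorter instance. *)
Lemma no_last_flips_drift k p n X w0 :
    full_upto k -> size p <= k -> nonrep w0 -> pattern w0 = rcons p n.+1 ->
  ~ drift (rcons p n.+1) (fun _ w => ~~ head_flips (rev w)) X.
Proof.
move=> fullk; have [m] := ubnP (size p).
elim: m p n X w0 => // m IHm [|i p] n X w0 lt_m le_k nw0 w0p dX.
  (* The letter 0 fixes this state, which does not flip, so [X] would differ from itself. *)
  have := dX false [:: pack (@ord_max n.+1.*2)] isT erefl.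
  rewrite /= /letter_step /= letter_perm_max flips_max.
  by case: (X _).
have [q0 [w0' w0E]] : exists q0 w, w0 = q0 :: w.
  by case: w0 w0p {nw0} => // q w _; exists q, w.
have nw0' : nonrep w0' by move: nw0; rewrite w0E nonrep_cons => /andP[].
have w0'p : pattern w0' = rcons p n.+1 by move: w0p; rewrite w0E => -[].
have [[w1 [a1 [b1 [[nw1 w1p] na1 nb1 Xab1]]]]|Xconst] :=
    pselect (exists w1 (a1 b1 : 'I_i.*2.+1),
      [/\ nonrep w1 /\ pattern w1 = rcons p n.+1, nonrep (pack a1 :: w1),
          nonrep (pack b1 :: w1) & X (pack a1 :: w1) != X (pack b1 :: w1)]); last first.
  have [|X' dX'] := @last_flips_drift_descend k i n p X fullk le_k dX w0 nw0 w0p.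
    move=> a b w ww na nb; apply/eqP; apply: contrapT => /negP Xab; apply: Xconst.
    by exists w, a, b.
  by apply: (IHm p n X' w0') => //; apply: ltnW.
have sepX := last_flips_drift_separates fullk le_k dX (conj nw1 w1p) na1 nb1 Xab1.
have [i1 p1] := last_flips_drift_one fullk le_k dX (conj nw1 w1p) na1 nb1 Xab1.
subst i; pose o := oriented_value X.
have oE y (z : 'I_1.*2.+1) w : nonrep (pack z :: w) ->
    pattern (pack z :: w) = rcons p n.+1 ->
    o (dual y (pack z :: w)) = o (pack z :: w) (+)
       ~~ head_flips (rev (pack z :: w)) (+) ~~ (y (+) parity (pack z :: w)).
  move=> nzw zwp; apply: oriented_value_dual => // [a c na nc ac|a na].
    by rewrite sepX //; split; rewrite ?nonrep_dual ?pattern_dual.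
  rewrite dX //; first by rewrite (@head_flips_rev_cons (pack a)).
  by rewrite -[pattern _]/(1%N :: pattern (pack z :: w)) zwp.
clearbody o; case: p lt_m le_k p1 w0p w0'p w1p {sepX dX na1 nb1 Xab1} oE => [|i p] lt_m le_k p1 w0p w0'p w1p oE.
  case: p1 => n0; rewrite n0 in oE.
  (* The state c_1 moves the same way on both letters, whereas the drift of [o] depends on the
     letter. *)
  pose c : 'I_1.*2.+1 := ord0.
  have cE : dual true [:: pack c] = dual false [:: pack c].
    by rewrite /= -[in LHS]letter_step_flips.
  have := oE true c [::] isT erefl; have := oE false c [::] isT erefl.
  by rewrite cE => ->; case: (o _); case: (head_flips _).
case: p1 => i1; subst i.
have [|p' [X' [p'E p'1 dX']]] := @flips_drift_head 1%N (rcons p n.+1) o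
    (fun y w => ~~ head_flips (rev w) (+) ~~ (y (+) parity w)).
  move=> y [j q] w nqw /= jq wp; subst j.
  have w_neq0 : w != [::] by case: w wp {nqw} => //; case: p {lt_m le_k w0p w0'p w1p oE}.
  rewrite -[pack _ :: _]/(dual y (pack q :: w)) oE //=; last by rewrite wp.
  rewrite head_flips_rev_cons //.
  by case: (o _) (head_flips _) y (parity w) (flips q) => [] [] [] [] [].
case: p' p'E p'1 dX' => // j p' p'E [j1] dX'; subst j.
(* Reversal turns the drift by the head into one by the last letter, again of component 1. *)
have := drift_rev dX'; rewrite rev_cons => dX''.
have [v [nv vp]] : exists v, nonrep v /\ pattern v = rcons (rev p') 1%N.
  case: p'E => [[p'E]|p'E].
    by exists (rev w1); rewrite nonrep_rev pattern_rev w1p p'E rev_cons.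
  case: w1 w1p nw1 => // q w1 [_ w1p] nw1.
  exists (rev w1); rewrite nonrep_rev pattern_rev w1p -p'E rev_cons; split=> //.
  by move: nw1; rewrite nonrep_cons => /andP[].
have size_p' : size (rev p') <= size (1%N :: p).
  by rewrite size_rev; case: p'E => [[->]|/(congr1 size)]; rewrite ?size_rcons //= => -[->].
apply: (IHm (rev p') 0 _ v _ _ nv vp dX'').
  by rewrite ltnS in lt_m; apply: leq_ltn_trans lt_m.
by apply: leq_trans size_p' (ltnW le_k).
Qed.

Lemma no_flips_drift k i p phi omega w0 :
    full_upto k -> size p <= k -> nonrep w0 -> pattern w0 = i.+1 :: p ->
  ~ (forall y q w, nonrep (q :: w) -> tag q = i.+1 -> pattern w = p ->
       phi (dual y (q :: w)) = phi (q :: w) (+) flips (tagged q) (+) omega y w).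
Proof.
move=> fullk le_k nw0 w0p /flips_drift_head[[|j p'] [X [p'E // [ji] dX]]]; subst j.
have := drift_rev dX; rewrite rev_cons.
have [v [nv vp]] : exists v, nonrep v /\ pattern v = i.+1 :: p'.
  case: p'E => [->|p'E]; first by exists w0.
  case: w0 w0p nw0 => // q w [_ wp] nqw; exists w; rewrite wp p'E; split=> //.
  by move: nqw; rewrite nonrep_cons => /andP[].
apply: (@no_last_flips_drift k _ _ _ (rev v)) => //; rewrite ?nonrep_rev //.
  by rewrite size_rev; case: p'E => [[->]//|p'E]; apply: leq_trans le_k; rewrite -p'E /=.
by rewrite pattern_rev vp rev_cons.
Qed.

(** A first letter of positive component falls under [no_flips_drift]. The single letter of
    component 0 is fixed and always flips; if the word goes on, a non-repeating one continues in
    another component, where the same lemma applies. *)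
Lemma no_parity_drift k s w0 :
    full_upto k -> size w0 <= k.+1 -> w0 != [::] -> nonrep w0 ->
  ~ drift (pattern w0) (fun _ w => parity w) s.
Proof.
move=> fullk le_k w0_neq0 nw0 ds.
case: w0 le_k w0_neq0 nw0 ds => // -[[|i] q] w le_k _ nqw ds; last first.
  apply: (@no_flips_drift k i (pattern w) s (fun _ => parity) (pack q :: w)) => //.
    by rewrite size_pattern.
  move=> y [j a] v nav /= ji vw; subst j.
  by rewrite -[pack _ :: _]/(dual y (pack a :: v)) ds /= ?vw // addbA.
have stepq y : letter_step y (pack q) = pack q.
  by congr existT; apply: val_inj; rewrite !ord1.
case: w le_k nqw ds => [|[j p] w] le_k nqw ds.
  have := ds false [:: pack q] isT erefl; rewrite /= stepq.
  by case: (s _).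
case: j p le_k nqw ds => [|j] p le_k nqw ds.
  by move: nqw; rewrite nonrep_cons /= (ord1 p) (ord1 q) eqxx.
have nw : nonrep (pack p :: w) by move: nqw; rewrite nonrep_cons => /andP[].
apply: (@no_flips_drift k j (pattern w) (fun w => s (pack q :: w))
    (fun y v => ~~ parity v) (pack p :: w)) => //.
  by rewrite size_pattern; apply: ltnW.
move=> y [i a] v nav /= ij vw; subst i.
have nqav : nonrep (pack q :: pack a :: v).
  by rewrite nonrep_cons nav andbT; apply/eqP => -[].
rewrite -[in LHS](stepq (y (+) parity (pack a :: v))).
rewrite -[_ :: _ :: _]/(dual y (pack q :: pack a :: v)) ds //=; last by rewrite vw.
by case: (s _) (flips a) (parity v) => [] [] [].
Qed.

(** * Independence of signs and the induction on length *)

Fixpoint parity_sum xs w : bool :=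
  if xs is x :: xs' then parity w (+) parity_sum xs' (dual x w) else false.

Lemma parity_sum_cat xs ys w :
  parity_sum (xs ++ ys) w = parity_sum xs w (+) parity_sum ys (run xs w).
Proof. by elim: xs w => //= x xs IHxs w; rewrite IHxs addbA. Qed.

(** In components of positive index a letter permutation is odd exactly on input 0, and the two
    inputs differ by the parity of the current word. *)
Lemma odd_labels i j xs w :
  odd_perm (label i.+1 xs) (+) odd_perm (label j.+1 (outs xs w)) = parity_sum xs w.
Proof.
elim: xs w => [|x xs IHxs] w /=; first by rewrite !odd_perm1.
rewrite !odd_permM !odd_letter_perm !andbT -IHxs.
by case: x (parity w) (odd_perm _) (odd_perm _) => [] [] [] [].
Qed.

(** If all loops had sum zero, summing the parity along any path from [w] would define a function on
    the orbit with the parity as its drift. *)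
Lemma odd_loop_exists k w :
    full_upto k -> size w <= k.+1 -> w != [::] -> nonrep w ->
  exists2 xs, run xs w = w & parity_sum xs w.
Proof.
move=> fullk le_k w_neq0 nw; apply: contrapT => no_loop.
have loop0 xs : run xs w = w -> parity_sum xs w = false.
  by move=> loop; apply/negbTE/negP => sum1; apply: no_loop; exists xs.
have path v : nonrep v -> pattern v = pattern w ->
    exists xs, run xs w = v /\ exists ys, run ys v = w.
  move=> nv vw; have [xs xsE] := run_transitive fullk le_k nw nv (esym vw).
  exists xs; split=> //; apply: (run_transitive fullk) => //.
  by rewrite -(size_pattern v) vw size_pattern.
pose s v := if pselect (exists xs, run xs w = v) is left xsP
            then parity_sum (projT1 (cid xsP)) w else false.
have sE xs v : run xs w = v -> nonrep v -> pattern v = pattern w ->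
    s v = parity_sum xs w.
  move=> xsE nv vw; rewrite /s; case: pselect => [ysP|[]]; last by exists xs.
  case: cid => ys /= ysE; have [_ [_ [zs zsE]]] := path v nv vw.
  have := loop0 (xs ++ zs); have := loop0 (ys ++ zs).
  rewrite !run_cat !parity_sum_cat xsE ysE zsE => /(_ erefl) + /(_ erefl).
  by case: (parity_sum ys w) (parity_sum xs w) (parity_sum zs v) => [] [] [].
apply: (@no_parity_drift k s w fullk) => // y v nv vw.
have [xs [xsE _]] := path v nv vw.
rewrite (sE (xs ++ [:: y])) ?nonrep_dual ?pattern_dual ?run_cat ?xsE //.
by rewrite (sE xs) // parity_sum_cat xsE /= addbF.
Qed.

Lemma free_letters_rcons w q n :
  w != [::] -> free_letters (rcons w q) n = free_letters w n.
Proof. by case: w. Qed.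

(** For a word [rcons w q], fullness of [w] and [rev w] makes the loops at [w] a subdirect product
    and an odd loop separates the signs. Goursat's argument then gives a loop acting as [r] in front
    and trivially behind, which extends over [q]. *)
Lemma full_upto_all k : full_upto k.
Proof.
elim: k => [|k fullk] w n nw; first by rewrite leqn0 size_eq0 => /eqP ->; apply: full_nil.
rewrite leq_eqVlt => /orP[/eqP sw|]; last exact: fullk.
case: k fullk sw => [|k] fullk sw.
  by case: w sw {nw} => [|q []] // _; apply: full_one.
case/lastP: w sw nw => // w q; rewrite size_rcons => -[sw] nwq.
have w_neq0 : w != [::] by rewrite -size_eq0 sw.
have nw : nonrep w.
  by move: nwq; rewrite -nonrep_rev rev_rcons nonrep_cons nonrep_rev => /andP[].
move=> r; rewrite free_letters_rcons // => Sr.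
case: n r Sr => [|n] r Sr.
  by exists [::] => //; apply/permP => x; rewrite !ord1.
suff [xs loop [fix_q lE]] : exists2 xs, run xs w = w &
    label (tag q) xs (tagged q) = tagged q /\ label n.+1 (outs xs w) = r.
  by have [ys loopy outsE] := rcons_loop loop fix_q; exists ys; rewrite ?outsE.
have full_w : full w n.+1 by apply: fullk; rewrite ?sw.
case: q {nwq} => -[|i] q /=.
  by have [xs loop lE] := full_w r Sr; exists xs => //; rewrite !ord1.
have full_rev : full (rev w) i.+1 by apply: fullk; rewrite ?nonrep_rev ?size_rev ?sw.
have [xs loop sum1] := odd_loop_exists fullk (leqW (eq_leq sw)) w_neq0 nw.
have Gxs : (label i.+1 xs, label n.+1 (outs xs w)) \in loops_group w i.+1 n.+1.
  by apply/mem_loops; exists xs.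
have : r \in right_kernel (loops_group w i.+1 n.+1).
  apply: (@full_right_kernel _ _ (free_letters (rev w) i.+1) (free_letters w n.+1)
    (loops_group w i.+1 n.+1) _ _ _ _ Gxs _ _ Sr).
  - by move=> l Sl; apply: loops_left.
  - by move=> s Ss; apply: loops_right.
  - by move=> p; apply: loops_perm_on.
  by rewrite /= negb_eqb odd_labels.
rewrite inE => /mem_loops[ys [loopy /= l1 lr]].
by exists ys => //; rewrite l1 perm1.
Qed.

(** Under a trivial action every word of the orbit has even parity, so the zero function would have
    the parity as its drift. *)
Lemma nonrep_nontrivial w :
  nonrep w -> w != [::] -> exists xs, outs xs w != xs.
Proof.
move=> nw w_neq0; apply: contrapT => trivial_w.
apply: (@no_parity_drift (size w) (fun=> false) w (@full_upto_all _)) => // y v nv vw.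
have [xs <-] := run_transitive (@full_upto_all _) (leqnSn _) nw nv (esym vw).
rewrite addFb; apply/esym/negbTE/negP => par1; apply: trivial_w.
exists (xs ++ [:: y]); rewrite outs_cat /= par1; apply/eqP => /(congr1 (drop (size xs))).
have size_outs v' : size (outs xs v') = size xs.
  by elim: xs v' {par1 nv vw} => //= x xs IHxs v'; rewrite IHxs.
rewrite -{1}(size_outs w) !drop_size_cat // => -[].
by case: y.
Qed.

End DualWords.

(** * Encoding the states of the automata *)

Definition encode n : state (bellaterra n) -> 'I_n.*2.+1 :=
  match n return state (bellaterra n) -> 'I_n.*2.+1 with
  | 0 => fun=> ord0
  | m.+1 => fun q => match q with
                     | Sa => inord m.*2.+1
                     | Sb => ord_max
                     | Sq i => inord i
                     end
  end.

Definition decode n : 'I_n.*2.+1 -> state (bellaterra n) :=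
  match n return 'I_n.*2.+1 -> state (bellaterra n) with
  | 0 => fun=> tt
  | m.+1 => fun j => if val j == m.+1.*2 then Sb else bell_q m.+1 j
  end.

Lemma chain_size m : 2 * m.+1 - 1 = m.*2.+1.
Proof. by rewrite mul2n doubleS subn1. Qed.

Lemma chain_ltn m (i : 'I_(2 * m.+1 - 1)) : i < m.*2.+1.
Proof. by have := ltn_ord i; move: (nat_of_ord i) => k; rewrite chain_size. Qed.

Lemma encode_Sq m (i : 'I_(2 * m.+1 - 1)) : val (@encode m.+1 (Sq i)) = i.
Proof.
by rewrite /= inordK // ltnS ltnW // -mul2n; apply: leq_trans (ltn_ord i) (leq_subr _ _).
Qed.

Lemma encode_Sa m : val (@encode m.+1 Sa) = m.*2.+1.
Proof. by rewrite /= inordK // doubleS !ltnS. Qed.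

Lemma encode_bell_q m i : i <= m.*2.+1 -> val (@encode m.+1 (bell_q m.+1 i)) = i.
Proof.
move=> le_i; rewrite /bell_q; case: insubP => [j _ <-|]; first exact: encode_Sq.
rewrite chain_size -leqNgt => ge_i; rewrite encode_Sa.
by apply/eqP; rewrite eqn_leq le_i ge_i.
Qed.

Lemma decodeK n : cancel (@decode n) (@encode n).
Proof.
case: n => [|m] j; apply: val_inj; first by rewrite !ord1.
rewrite [decode j]/=; case: eqP => [jE|/eqP j_max]; first by rewrite [RHS]jE.
by rewrite encode_bell_q // -ltnS ltn_neqAle j_max -ltnS ltn_ord.
Qed.

Lemma encodeK n : cancel (@encode n) (@decode n).
Proof.
case: n => [[]|m] //= [||i].
- rewrite inordK ?doubleS ?ltnS // ltn_eqF // /bell_q.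
  by rewrite insubN // chain_size ltnn.
- by rewrite eqxx.
have iE := encode_Sq i; rewrite /= in iE; rewrite iE.
have lt_i := chain_ltn i.
rewrite ltn_eqF; last by rewrite doubleS ltnW.
by rewrite /bell_q valK.
Qed.

Lemma encode_output n (q : state (bellaterra n)) x :
  output q x = x (+) flips (encode q).
Proof.
case: n q => [|m] q; first by rewrite /= addbT.
case: q => [||i].
- by rewrite /flips encode_Sa /= doubleS ltnn addbF.
- by rewrite flips_max addbF.
by rewrite /flips encode_Sq /= doubleS ltnS chain_ltn addbT.
Qed.

Lemma encode_trans n (q : state (bellaterra n)) x :
  encode (trans q x) = letter_perm n x (encode q).
Proof.
case: n q => [|m] q; first by rewrite !ord1.
apply: val_inj; case: q => [||i].
- have rotE : rot_perm m.+1.*2 (@encode m.+1 Sa) = ord_max.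
    by apply: val_inj; rewrite permE /= inordK ?modn_small ?doubleS ?ltnS.
  case: x; first by rewrite /letter_perm rotE.
  by rewrite /letter_perm permM rotE tpermR encode_bell_q.
- case: x; last by rewrite letter_perm_max.
  by rewrite encode_bell_q // permE /= modnn.
have lt_i := chain_ltn i.
have flips_i : flips (@encode m.+1 (Sq i)) by rewrite /flips encode_Sq.
rewrite [trans _ _]/= encode_bell_q //.
have -> : letter_perm m.+1 x (@encode m.+1 (Sq i)) = rot_perm m.+1.*2 (@encode m.+1 (Sq i)).
  have := letter_perm_flips (@encode m.+1 (Sq i)) true.
  by rewrite flips_i; case: x.
rewrite permE [val (ordS _)]/= -[inord _]/(@encode m.+1 (Sq i)) encode_Sq.
by rewrite modn_small // doubleS !ltnS ltnW.
Qed.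

(** * Groups generated by involutions without further relations *)

Section WordProduct.
Variables (Q : eqType) (G : groupType) (gen : Q -> G).

Definition word_product w : G := foldr (fun q g => gen q * g) 1 w.

Lemma word_product_cat w v : word_product (w ++ v) = word_product w * word_product v.
Proof. by elim: w => [|q w /= ->]; rewrite ?mul1g ?mulgA. Qed.

Hypothesis gen_invol : forall q, gen q * gen q = 1.

Lemma word_product_rev w : word_product (rev w) * word_product w = 1.
Proof.
elim: w => [|q w IHw]; first by rewrite mul1g.
rewrite rev_cons -cats1 word_product_cat /= mulg1 -mulgA (mulgA (gen q)).
by rewrite gen_invol mul1g.
Qed.

End WordProduct.

Lemma unsorted_neq_split (Q : eqType) w :
  ~~ sorted (fun p q : Q => p != q) w -> exists u q v, w = u ++ [:: q, q & v].
Proof.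
elim: w => // p [|q w] //= IHw; rewrite negb_and negbK => /orP[/eqP <-|/IHw].
  by exists [::], p, w.
by move=> [u [r [v E]]]; exists (p :: u), r, v; rewrite E.
Qed.

Section InvolutionExtension.
Variables (Q : eqType) (G K : groupType) (gen : Q -> G) (f : Q -> K).
Hypothesis gen_invol : forall q, gen q * gen q = 1.
Hypothesis f_invol : forall q, f q * f q = 1.
Hypothesis gen_onto : forall g, exists w, word_product gen w = g.
Hypothesis gen_free : forall w, sorted (fun p q : Q => p != q) w -> w != [::] ->
  word_product gen w != 1.

(** Cancelling two equal adjacent letters preserves both products; the non-repeating word that
    remains is empty by [gen_free]. *)
Lemma word_product_relation w : word_product gen w = 1 -> word_product f w = 1.
Proof.
have [m] := ubnP (size w); elim: m w => // m IHm w lt_m w1.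
have [sw|/unsorted_neq_split[u [q [v wE]]]] := boolP (sorted (fun p q : Q => p != q) w).
  by have [->//|w_neq0] := eqVneq w [::]; have := gen_free sw w_neq0; rewrite w1 eqxx.
move: lt_m w1; rewrite wE size_cat /= !addnS ltnS => lt_m.
rewrite !word_product_cat /= (mulgA (gen q)) gen_invol (mulgA (f q)) f_invol !mul1g.
rewrite -!word_product_cat.
by apply: IHm; rewrite size_cat; apply: leq_trans lt_m; rewrite ltnS.
Qed.

Lemma word_product_eq w v :
  word_product gen w = word_product gen v -> word_product f w = word_product f v.
Proof.
move=> wv; have := @word_product_relation (rev v ++ w).
rewrite !word_product_cat wv word_product_rev // => /(_ erefl) fvw.
by rewrite -[RHS]mulg1 -fvw mulgA -{1}(revK v) word_product_rev // mul1g.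
Qed.

Definition involution_extension (g : G) : K :=
  word_product f (projT1 (cid (gen_onto g))).

Lemma involution_extensionE w :
  involution_extension (word_product gen w) = word_product f w.
Proof. by rewrite /involution_extension; case: cid => v /= /word_product_eq. Qed.

Lemma involution_extensionM :
  {morph involution_extension : g h / g * h}.
Proof.
move=> g h; have [w <-] := gen_onto g; have [v <-] := gen_onto h.
by rewrite -word_product_cat !involution_extensionE word_product_cat.
Qed.

Lemma extend_involutions :
  exists phi : {multiplicative G -> K}, forall q, phi (gen q) = f q.
Proof.
pose phi : {multiplicative G -> K} :=
  HB.pack involution_extension (isMultiplicative.Build G K _ involution_extensionM).
exists phi => q; rewrite -[gen q]mulg1 -[f q]mulg1.
exact: (involution_extensionE [:: q]).
Qed.

End InvolutionExtension.

(** * The automaton group and its generators *)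

Lemma actE N (N_neq0 : N != fset0%fset) (q : state (bellaterra_union N_neq0)) xs :
  Defs.act q xs = outs xs [:: pack (encode (tagged q))].
Proof.
elim: xs q => //= x xs IHxs [i q] /=.
by rewrite IHxs /= addbF encode_output encode_trans /letter_step /= addbF.
Qed.

Section BellaterraGroup.
Variables (N : {fset nat}) (N_neq0 : N != fset0%fset).
Notation Y := (bellaterra_union N_neq0).
Notation invY := (@bellaterra_union_invertible N N_neq0).
Notation G := (automaton_group invY).

(** Restricting the components to [N] gives a finite type of letters, whose elements index the free
    factors. *)
Definition index := {n : N & 'I_(val n).*2.+1}.

Definition index_state (l : index) : state Y :=
  Tagged (fun n : N => state (bellaterra (val n))) (decode (tagged l)).

Definition index_letter (l : index) : letter := pack (tagged l).

Lemma index_letter_inj : injective index_letter.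
Proof.
move=> [i q] [j p] /eqP E; have /eqP/val_inj ij : val i == val j.
  by move: E; rewrite -tag_eqE => /andP[].
by subst j; move: E; rewrite eq_Tagged /= => /eqP ->.
Qed.

Lemma generator_subproof l : Defs.Sym (invY (index_state l)) \in
  gen_by (fun s : sym (seq bool) => exists q : state Y, s = Defs.Sym (invY q)).
Proof. by apply/asboolP => S _; apply; exists (index_state l). Qed.

Definition generator l : G :=
  exist (fun s => s \in gen_by _) _ (generator_subproof l).

Lemma generatorE l xs : val (generator l) xs = outs xs [:: index_letter l].
Proof. by rewrite -[LHS]/(Defs.act (index_state l) xs) actE decodeK. Qed.

Lemma generator_word_product (w : seq index) xs :
  val (word_product generator w) xs = outs xs (map index_letter w).
Proof.
elim: w xs => [|l w IHw] xs; first by rewrite outs_nil.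
rewrite -[LHS]/(val (generator l) (val (word_product generator w) xs)) IHw generatorE.
by rewrite -outs_cons.
Qed.

Lemma generator_invol l : generator l * generator l = 1.
Proof.
apply/val_inj/sym_ext => xs.
rewrite -[LHS]/(val (generator l) (val (generator l) xs)) !generatorE.
exact: (outs_rev xs [:: index_letter l]).
Qed.

Lemma generator_onto g : exists w, word_product generator w = g.
Proof.
case: g => s sG; have /asboolP sP := sG.
pose S : {pred sym (seq bool)} :=
  fun t => `[< exists w, val (word_product generator w) = t >].
have /asboolP[w ws] : s \in S.
  apply: sP => [|a [[i q] ->]]; last first.
    apply/asboolP; exists [:: Tagged (fun n : N => 'I_(val n).*2.+1) (encode q)].
    apply: sym_ext => xs /=; congr (Defs.act _ xs).
    by rewrite /index_state /= encodeK.
  split=> [|t u /asboolP[w <-] /asboolP[v <-]]; first by apply/asboolP; exists [::].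
  apply/asboolP; exists (w ++ rev v); rewrite word_product_cat.
  have -> : word_product generator (rev v) = (word_product generator v)^-1.
    by apply: (mulIg (word_product generator v)); rewrite mulVg word_product_rev //; apply: generator_invol.
  exact: gmulfF.
by exists w; apply: val_inj.
Qed.

Lemma generator_free (w : seq index) :
  sorted (fun p q => p != q) w -> w != [::] -> word_product generator w != 1.
Proof.
move=> sw w_neq0; have [||xs] := @nonrep_nontrivial (map index_letter w).
- rewrite /nonrep sorted_map; move: sw; congr is_true; apply: eq_sorted => p q.
  by rewrite /= (inj_eq index_letter_inj).
- by rewrite -size_eq0 size_map size_eq0.
by apply: contraNneq => w1; rewrite -generator_word_product w1.
Qed.

Lemma card_index : #|{: index}| = \sum_(n <- N) (2 * n + 1).
Proof.
rewrite card_tagged sumnE big_map big_enum /= big_seq_fsetE /=.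
by apply: eq_bigr => n _; rewrite card_ord -mul2n addn1.
Qed.

End BellaterraGroup.

(** * Factors of order two and the universal property *)

Section InvolutionMorphism.
Variables (G : groupType) (a : G).
Hypothesis a_invol : a * a = 1.

Definition involution_map (b : 'I_2) : G := if b == ord0 then 1 else a.

Lemma involution_mapM : {morph involution_map : b c / b * c}.
Proof.
case=> [[|[|//]] b2] [[|[|//]] c2]; rewrite /involution_map -!val_eqE /=.
- by rewrite mulg1.
- by rewrite mul1g.
- by rewrite mulg1.
by rewrite a_invol.
Qed.

Definition involution_morphism : {multiplicative 'I_2 -> G} :=
  HB.pack involution_map (isMultiplicative.Build 'I_2 G _ involution_mapM).

End InvolutionMorphism.
Close Scope group_scope.

Theorem theorem1p6 (N : {fset nat}) (N_neq0 : N != fset0) :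
  exists (H : 'I_(\sum_(n <- N) (2 * n + 1)) -> finGroupType)
         (iota : forall i, {multiplicative H i ->
                   automaton_group (@bellaterra_union_invertible N N_neq0)}),
    (forall i, #|H i| = 2) /\ is_free_product iota.
Proof.
pose idx i : index N := enum_val (cast_ord (esym (card_index N)) i).
pose rank (l : index N) := cast_ord (card_index N) (enum_rank l).
have rankK l : idx (rank l) = l by rewrite /idx /rank cast_ordK enum_rankK.
have idxK i : rank (idx i) = i by rewrite /idx /rank enum_valK cast_ordKV.
exists (fun=> 'I_2 : finGroupType),
  (fun i => involution_morphism (generator_invol N_neq0 (idx i))).
split=> [i|K f]; first exact: card_ord.
pose one2 : 'I_2 := ord_max.
have f1 i : f i 1%g = 1%g by apply: (mulgI (f i 1%g)); rewrite -gmulfM !mulg1.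
have f_invol l : (f (rank l) one2 * f (rank l) one2)%g = 1%g.
  rewrite -gmulfM (_ : one2 * one2 = 1)%g ?f1 //; exact: val_inj.
have [phi phiE] := extend_involutions (@generator_invol _ N_neq0) f_invol
  (@generator_onto _ N_neq0) (@generator_free _ N_neq0).
have mor1 (psi : {multiplicative
    automaton_group (@bellaterra_union_invertible N N_neq0) -> K}) : psi 1%g = 1%g.
  by apply: (mulgI (psi 1%g)); rewrite -gmulfM !mulg1.
exists phi; split=> [i b|psi psiE g] /=.
  case: b => [[|[|//]] b2] /=; rewrite /involution_map -val_eqE /=.
    by rewrite mor1 -(f1 i); congr (f _ _); apply: val_inj.
  by rewrite phiE idxK; congr (f _ _); apply: val_inj.
(* Uniqueness: the generators are the images of the nontrivial elements [one2], and their products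
   exhaust the group. *)
have [w <-] := generator_onto g; elim: w => [|l w IHw] /=; first by rewrite !mor1.
rewrite !gmulfM IHw phiE -(psiE (rank l) one2) /= rankK.
by [].
Qed.
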